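(* Fix an integer $d\ge2$ and a class $\mathcal{P}$ of graphs that is block-hereditary, recognizable in polynomial time, and consists only of chordal graphs. Let $(G_1,S)$, $(G_2,S)$, $(H,S)$ be $d$-labeled $\mathcal{P}$-block boundaried graphs such that (i) for each $i\in\{1,2\}$, $(G_i,S)$ is compatible with $(H,S)$; (ii) $(G_1,S)$ and $(G_2,S)$ have the same characteristic $(g,h)$; and (iii) $\mathbf{Aux}(G_2,S)\oplus\mathbf{Aux}(H,S)$ has no cycles. If $(G_1,S)\oplus(H,S)$ is a $d$-labeled $\mathcal{P}$-block graph that respects $(g,h)$, then $(G_2,S)\oplus(H,S)$ is a $d$-labeled $\mathcal{P}$-block graph that respects $(g,h)$.
   Context: A graph is biconnected if connected with no cut vertex; a block is a maximal biconnected subgraph; a block is non-trivial if it has at least two vertices. A graph is chordal if it has no induced cycle of length at least $4$. $\mathcal{P}$ is block-hereditary if every biconnected induced subgraph of a graph in $\mathcal{P}$ is in $\mathcal{P}$. A $\mathcal{P}$-block graph is a graph all of whose blocks lie in $\mathcal{P}$. A block $d$-labeling of a graph whose blocks have at most $d$ vertices is a map $L:V(G)\to[d]$ injective on each block; a $d$-labeled $\mathcal{P}$-block graph is a $\mathcal{P}$-block graph with a block $d$-labeling. Two $d$-labeled graphs are label-isomorphic if there is a label-preserving isomorphism; a biconnected $d$-labeled graph $F$ is partially label-isomorphic to a biconnected $d$-labeled graph $Q$ if $F$ is label-isomorphic to the subgraph of $Q$ induced by the vertices whose labels appear in $F$. $\mathcal{U}_d$ is the set of all biconnected $d$-labeled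 $\mathcal{P}$-block graphs. A boundaried graph is a pair $(G,S)$ with $S\subseteq V(G)$; $\mathrm{Block}(G,S)$ is the set of non-trivial blocks of $G[S]$; an $S$-block of $G$ is a block of $G$ containing an edge of $G[S]$ (each $B\in\mathrm{Block}(G,S)$ lies in a unique $S$-block). $d$-labeled $(G,S),(H,S)$ are compatible if $V(G-S)\cap V(H-S)=\emptyset$, $G[S]=H[S]$ and labels agree on $S$; their sum $(G,S)\oplus(H,S)$ is the disjoint union of $G$ and $H$ with corresponding vertices of $S$ identified and duplicate edges inside $S$ removed, labeled by $L_G\oplus L_H$ (each vertex gets its label from $G$ or $H$). For a $d$-labeled $(G,S)$ with labeling $L$, a characteristic of $(G,S)$ is a pair $(g,h)$ with $g:\mathrm{Block}(G,S)\to\mathcal{U}_d$ and $h:\mathrm{Block}(G,S)\to 2^{[d]}$ such that for each $B\in\mathrm{Block}(G,S)$ and the $S$-block $X$ of $G$ containing $B$: (a) $X$ is partially label-isomorphic to $g(B)$; (b) $g(B')=g(B)$ for every $B'\in\mathrm{Block}(G,S)$ contained in $X$; (c) $h(B)=L(N_X(V(B))\setminus S)$; (d) for every vertex $w$ with $w\in V(X)\setminus S$ or with $\{w\}=V(X)\cap V(C)$ for some component $C$ of $G[S]$, $X[N_X[w]]$ is label-isomorphic to $g(B)[N_{g(B)}[z]]$, where $z$ is the vertex of $g(B)$ with label $L(w)$. For $(G,S)$ with characteristic $(g,h)$ and a compatible $(H,S)$, the sum $(G,S)\oplus(H,S)$ respects $(g,h)$ if for each $B\in\mathrm{Block}(G,S)$,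 the $S$-block of the sum containing $B$ (a block of the sum containing an edge of $G[S]$) is label-isomorphic to $g(B)$. $\mathbf{Aux}(G,S)$ is the bipartite graph whose vertices are the connected components of $G$ and of $G[S]$, a component $C_1$ of $G$ adjacent to a component $C_2$ of $G[S]$ iff $C_2\subseteq C_1$; $\mathbf{Aux}(G,S)\oplus\mathbf{Aux}(H,S)$ is their disjoint union with vertices corresponding to the same component of $G[S]=H[S]$ identified. *)

(* Defs.v *)
From mathcomp Require Import all_boot.
Set Implicit Arguments. Unset Strict Implicit. Unset Printing Implicit Defensive.

Record graph (T : finType) := Graph { gV : {set T}; gE : {set T * T} }.

Section Graphs.
Variable T : finType.
Implicit Types (G H : graph T) (X Y S A : {set T}).

Definition wf G : Prop :=
  (forall x y, (x, y) \in gE G -> (y, x) \in gE G) /\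
  (forall x, (x, x) \notin gE G) /\
  (forall x y, (x, y) \in gE G -> (x \in gV G) && (y \in gV G)).

Definition adj G : rel T :=
  fun x y => [&& (x, y) \in gE G, x \in gV G & y \in gV G].

Definition conn G (x y : T) : bool := connect (adj G) x y.

Definition induced G X : graph T :=
  Graph (X :&: gV G) [set p in gE G | (p.1 \in X) && (p.2 \in X)].

Definition connected G : Prop :=
  gV G != set0 /\ {in gV G &, forall x y, conn G x y}.

Definition cut_vertex G (v : T) : Prop :=
  v \in gV G /\ exists x y, [/\ x \in gV G :\ v, y \in gV G :\ v, conn G x y &
                             ~~ conn (induced G (gV G :\ v)) x y].

Definition biconnected G : Prop := connected G /\ ~ exists v, cut_vertex G v.

Definition is_block G X : Prop :=
  [/\ X \subset gV G, biconnected (induced G X) &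
      forall Y, X \proper Y -> Y \subset gV G -> ~ biconnected (induced G Y)].

Definition is_comp G (C : {set T}) : bool :=
  [exists x in gV G, C == [set y in gV G | conn G x y]].

Definition comps G : {set {set T}} := [set C | is_comp G C].

Definition induced_cycle G (s : seq T) : Prop :=
  [/\ uniq s, {subset s <= gV G}, cycle (adj G) s &
      {in s &, forall x y, adj G x y -> (y == next s x) || (x == next s y)}].

Definition chordal G : Prop :=
  forall s, 4 <= size s -> ~ induced_cycle G s.

Definition acyclic G : Prop :=
  forall s : seq T, uniq s -> {subset s <= gV G} -> 3 <= size s -> ~~ cycle (adj G) s.

Definition nbhd G A : {set T} :=
  [set w in gV G | [exists v in A, adj G v w]] :\: A.
Definition cnbhd G (w : T) : {set T} := w |: [set u | adj G w u].

End Graphs.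

Definition iso (T1 T2 : finType) (G1 : graph T1) (G2 : graph T2) : Prop :=
  exists f : T1 -> T2, [/\ {in gV G1 &, injective f}, f @: gV G1 = gV G2 &
     {in gV G1 &, forall x y, ((f x, f y) \in gE G2) = ((x, y) \in gE G1)}].

Definition liso (d : nat) (T1 T2 : finType) (G1 : graph T1) (L1 : T1 -> 'I_d)
    (G2 : graph T2) (L2 : T2 -> 'I_d) : Prop :=
  exists f : T1 -> T2, [/\ {in gV G1 &, injective f}, f @: gV G1 = gV G2,
     {in gV G1 &, forall x y, ((f x, f y) \in gE G2) = ((x, y) \in gE G1)} &
     {in gV G1, forall x, L2 (f x) = L1 x}].

Definition gclass := forall T : finType, graph T -> Prop.

Definition iso_closed (P : gclass) : Prop :=
  forall (T1 T2 : finType) (G1 : graph T1) (G2 : graph T2),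
    iso G1 G2 -> P T1 G1 -> P T2 G2.

Definition block_hereditary (P : gclass) : Prop :=
  forall (T : finType) (G : graph T) (X : {set T}),
    P T G -> biconnected (induced G X) -> P T (induced G X).

Definition chordal_class (P : gclass) : Prop :=
  forall (T : finType) (G : graph T), P T G -> chordal G.

Definition Pblock (P : gclass) (T : finType) (G : graph T) : Prop :=
  forall X, is_block G X -> P T (induced G X).

Definition block_labeling (d : nat) (T : finType) (G : graph T) (L : T -> 'I_d) : Prop :=
  forall X, is_block G X -> {in X &, injective L}.

Definition labeled_Pblock (P : gclass) (d : nat) (T : finType) (G : graph T)
    (L : T -> 'I_d) : Prop :=
  wf G /\ Pblock P G /\ block_labeling G L.

(* U_d: biconnected d-labeled P-block graphs, up to label-isomorphism.
   Since the labeling of a biconnected block-labeled graph is injective,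
   each label-isomorphism class has a unique representative on a vertex
   set of labels ('I_d) labeled by the identity. *)
Definition Ud (P : gclass) (d : nat) (Q : graph 'I_d) : Prop :=
  wf Q /\ biconnected Q /\ Pblock P Q.

Section Boundaried.
Variables (P : gclass) (d : nat) (T : finType).
Implicit Types (G H : graph T) (S B X : {set T}).

Definition labeled_bgraph G S (L : T -> 'I_d) : Prop :=
  S \subset gV G /\ labeled_Pblock P G L.

Definition BlockS G S B : Prop := is_block (induced G S) B /\ 1 < #|B|.

Definition partial_liso (F : graph T) (L : T -> 'I_d) (Q : graph 'I_d) : Prop :=
  liso F L (induced Q (L @: gV F)) id.

Definition characteristic G S (L : T -> 'I_d)
    (g : {set T} -> graph 'I_d) (h : {set T} -> {set 'I_d}) : Prop :=
  forall B, BlockS G S B -> Ud P (g B) /\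
  forall X, is_block G X -> B \subset X ->
    [/\ (* (a) *) partial_liso (induced G X) L (g B),
        (* (b) *) (forall B', BlockS G S B' -> B' \subset X -> g B' = g B),
        (* (c) *) h B = L @: (nbhd (induced G X) B :\: S) &
        (* (d) *) (forall w,
             (w \in X :\: S \/
              exists C, is_comp (induced G S) C /\ X :&: C = [set w]) ->
             liso (induced (induced G X) (cnbhd (induced G X) w)) L
                  (induced (g B) (cnbhd (g B) (L w))) id)].

Definition compatible G (LG : T -> 'I_d) H (LH : T -> 'I_d) S : Prop :=
  [/\ [disjoint gV G :\: S & gV H :\: S], induced G S = induced H S &
      {in S, forall x, LG x = LH x}].

Definition gsum G H : graph T := Graph (gV G :|: gV H) (gE G :|: gE H).
Definition lsum G (LG LH : T -> 'I_d) : T -> 'I_d :=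
  fun x => if x \in gV G then LG x else LH x.

Definition respects G S (LG : T -> 'I_d) H (LH : T -> 'I_d)
    (g : {set T} -> graph 'I_d) : Prop :=
  forall B, BlockS G S B ->
  forall X, is_block (gsum G H) X -> B \subset X ->
    liso (induced (gsum G H) X) (lsum G LG LH) (g B) id.

(* Aux(G,S) (+) Aux(H,S): vertices are components of G (inl (inl _)),
   components of H (inl (inr _)) and components of G[S] = H[S] (inr _). *)
Definition aux_edge (u v : ({set T} + {set T}) + {set T}) : bool :=
  match u, v with
  | inl (inl C1), inr C2 | inr C2, inl (inl C1)
  | inl (inr C1), inr C2 | inr C2, inl (inr C1) => C2 \subset C1
  | _, _ => false
  end.

Definition aux_sum G H S : graph (({set T} + {set T}) + {set T})%type :=
  Graph ([set inl (inl C) | C in comps G] :|: [set inl (inr C) | C in comps H]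
           :|: [set inr C | C in comps (induced G S)])
        [set p | aux_edge p.1 p.2].

End Boundaried.

(* Main.v *)
(** Write [K1] and [K2] for the sums of [G1] and [G2] with [H]. A block [X] of [K2]
without an edge inside [S] lies in [G2] or in [H]; a block containing
[B \in Block(G2, S)] is compared with [Q = g B] through its labels.

Acyclicity of the auxiliary graph says that every 0/1-function on [S] that is constant
on components of [G2[S]] is a sum of functions constant on the components of [G2] and of
[H]. It follows that an edge colouring which is constant on the blocks of [G2] and on
those of [H] is constant on the blocks of [K2], because the potentials witnessing this on
[G2 - v] and on [H - v] can be glued. Hence every edge of [X] lies in a block of [G2] or
of [H] on which the characteristic takes the value [Q], and labels map edges of [X] to
edges of [Q].

For an edge [wu] of [X], labels biject the common neighbours of [w] and [u] in [X] with
those in [Q]: by (d) if an end is in [G2 - S], by comparison with the block of [K1] if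
an end is in [H - S], and by (c) together with that block if [w] and [u] are in [S], as
[h] then transports common neighbours between [G1] and [G2]. Links of vertices in [X] are
connected, again by gluing potentials. Finally a locally bijective map onto a chordal
graph that reflects adjacency of neighbours is injective on connected sets: a shortest
walk between two points of a fibre would give an induced cycle. Used on links, this makes
labels bijective on vertex neighbourhoods; used on [X], it gives [X] isomorphic to [Q]. *)

Require Import Defs.
From mathcomp Require Import all_boot.
From mathcomp Require Import boolp zify.

Set Implicit Arguments.
Unset Strict Implicit.
Unset Printing Implicit Defensive.

(** * Connectivity and blocks *)

Section Connectivity.
Variable T : finType.
Implicit Types (e : rel T) (X Y : {set T}) (f : T -> bool) (G F : graph T).

(* [X] is [e]-connected: only constant functions are locally constant. *)
Definition cnx e X : Prop := forall f,
  {in X &, forall x y, e x y -> f x = f y} -> {in X &, forall x y, f x = f y}.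

(** Biconnectedness is stated for a vertex set under an ambient relation, so that it passes between
    graphs agreeing on that set. Singletons qualify, and a [v] outside [X] only repeats the
    connectedness clause. *)
Definition bic e X : Prop :=
  [/\ X != set0, cnx e X & forall v, cnx e (X :\ v)].

Lemma cnx_eq e e' X : {in X &, e =2 e'} -> cnx e X -> cnx e' X.
Proof.
by move=> ee' cX f fE; apply: cX => x y xX yX; rewrite ee' //; apply: fE.
Qed.

Lemma bic_eq e e' X : {in X &, e =2 e'} -> bic e X -> bic e' X.
Proof.
move=> ee' [X0 cX cXv]; split=> // [|v]; first exact: cnx_eq cX.
by apply: cnx_eq (cXv v) => x y /setD1P[_ xX] /setD1P[_ yX]; apply: ee'.
Qed.

Definition rel_in e X : rel T := fun a b => [&& e a b, a \in X & b \in X].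

(** The indicator of the vertices reachable from [x] inside [X] is locally constant; conversely a
    locally constant function is constant along any path. *)
Lemma cnx_connect e X : symmetric e ->
  cnx e X <-> {in X &, forall x y, connect (rel_in e X) x y}.
Proof.
move=> es; set r := rel_in e X.
have rs : connect_sym r.
  by apply: sym_connect_sym => a b; rewrite /r /rel_in es [(a \in X) && _]andbC.
split=> [cX x y xX yX | cX f fE x y xX yX].
  rewrite -(cX (connect r x) _ x y) ?connect0 // => a b aX bX ab.
  by apply: same_connect_r => //; apply: connect1; rewrite /r /rel_in ab aX bX.
have /connectP[p pp ->] := cX x y xX yX.
elim: p {y yX} x {xX} pp => //= z p IHp x /andP[/and3P[xz xX zX] pp].
by rewrite (fE x z) // (IHp z).
Qed.

(** Whichever vertex is deleted, [x] or [y] survives and joins the two connected remainders. *)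
Lemma bic_setU e X Y x y : bic e X -> bic e Y -> x != y ->
  x \in X -> x \in Y -> y \in X -> y \in Y -> bic e (X :|: Y).
Proof.
move=> [X0 cX cXv] [_ cY cYv] xy xX xY yX yY.
have glue (A B : {set T}) z : z \in A -> z \in B -> cnx e A -> cnx e B -> cnx e (A :|: B).
  move=> zA zB cA cB f fE.
  have fz w : w \in A :|: B -> f w = f z.
    case/setUP=> wA; [apply: (cA f) | apply: (cB f)] => // a b aA bA.
      by apply: fE; rewrite inE ?aA ?bA.
    by apply: fE; rewrite inE ?aA ?bA orbT.
  by move=> a b /fz-> /fz->.
split=> [||v]; first by apply/set0Pn; exists x; rewrite inE xX.
  exact: (glue _ _ x).
rewrite setDUl; have [vx|vx] := eqVneq v x.
  by apply: (glue _ _ y) => //; rewrite !inE ?yX ?yY vx eq_sym xy.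
by apply: (glue _ _ x) => //; rewrite !inE ?xX ?xY eq_sym vx.
Qed.

(** Rotating the cycle to start at the deleted vertex leaves a path. Two-element lists are allowed,
    so single edges are covered as well. *)
Lemma bic_cycle e s : s != [::] -> uniq s -> cycle e s -> bic e [set x in s].
Proof.
have path_cnx x p : path e x p -> cnx e [set y in x :: p].
  move=> pp f fE.
  have fx y : y \in x :: p -> f y = f x.
    elim: p x pp fE => [|z p IHp] x /=; first by move=> _ _; rewrite inE => /eqP->.
    case/andP=> xz pp fE; rewrite inE => /predU1P[-> //|yp].
    rewrite (IHp z) //; first by symmetry; apply: fE => //; rewrite !inE eqxx ?orbT.
    by move=> a b; rewrite !inE => aP bP; apply: fE; rewrite !inE ?aP ?bP orbT.
  by move=> a b; rewrite !inE => aP bP; rewrite !fx ?inE.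
case: s => // x0 s _ us cs.
split=> [||v].
- by apply/set0Pn; exists x0; rewrite !inE eqxx.
- by apply: path_cnx; move: cs; rewrite /= rcons_path => /andP[].
have [vs|vs] := boolP (v \in x0 :: s); last first.
  have -> : [set x in x0 :: s] :\ v = [set x in x0 :: s].
    by apply/setP=> y; rewrite in_setD1 !in_set; case: eqP => // ->; rewrite (negPf vs).
  by apply: path_cnx; move: cs; rewrite /= rcons_path => /andP[].
have [i t def] := rot_to vs.
have ct : cycle e (v :: t) by rewrite -def rot_cycle.
have ut : uniq (v :: t) by rewrite -def rot_uniq.
have -> : [set x in x0 :: s] :\ v = [set x in t].
  apply/setP=> y; rewrite in_setD1 !in_set -(mem_rot i) def inE.
  by case: eqP => //= ->; move: ut => /= /andP[/negPf->].
case: t ct {def ut} => [|z t] /= ct; first by move=> f _ x y; rewrite inE.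
by apply: path_cnx; move: ct; rewrite rcons_path => /andP[_ /andP[]].
Qed.

Lemma bic_edge e x y : symmetric e -> x != y -> e x y -> bic e [set x; y].
Proof.
move=> es xy exy.
suff -> : [set x; y] = [set z in [:: x; y]].
  by apply: bic_cycle; rewrite /= ?inE ?xy ?exy // es exy.
by apply/setP=> z; rewrite !inE.
Qed.

Lemma bic_triangle e x y z : symmetric e -> irreflexive e ->
  e x y -> e y z -> e x z -> bic e [set w in [:: x; y; z]].
Proof.
move=> es ei xy yz xz.
have ne a b : e a b -> a != b by apply: contraTneq => ->; rewrite ei.
by apply: bic_cycle; rewrite /= ?inE ?negb_or ?ne // xy yz es xz.
Qed.

(** A simple path from [a] to [b] avoiding [v] closes up through [v] to a cycle; for [a = b] this
    degenerates to an edge. *)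
Lemma bic_neighbours e v a b : symmetric e -> irreflexive e -> e v a -> e v b ->
  connect (fun x y => [&& e x y, x != v & y != v]) a b ->
  exists X, [/\ bic e X, v \in X, a \in X & b \in X].
Proof.
move=> es ei va vb /connectP[p0 pp0 lb].
have nav : a != v by apply: contraTneq va => ->; rewrite ei.
move: lb; have [p pp up _ lb] := shortenP pp0.
exists [set x in v :: a :: p]; rewrite !inE !eqxx ?orbT; split=> //.
  apply: bic_cycle => //.
    rewrite /= in up *; rewrite up andbT inE negb_or eq_sym nav /=.
    elim: p a pp {up va nav lb pp0} => //= z p IHp x /andP[/and3P[_ _ zv] pp].
    by rewrite inE negb_or eq_sym zv (IHp z).
  rewrite /= va /= rcons_path -lb es vb andbT.
  by apply: sub_path pp => x y /and3P[].
by move: (mem_last a p); rewrite -lb inE => ->; rewrite orbT.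
Qed.

Lemma wf_sym G : wf G -> symmetric (adj G).
Proof.
move=> [s _]; have h x y : adj G x y -> adj G y x.
  by case/and3P=> /s xy xG yG; apply/and3P.
by move=> x y; apply/idP/idP; apply: h.
Qed.

Lemma wf_irr G : wf G -> irreflexive (adj G).
Proof. by move=> [_ [i _]] x; rewrite /adj (negPf (i x)). Qed.

Lemma wf_gE G x y : wf G -> ((x, y) \in gE G) = adj G x y.
Proof.
move=> [_ [_ w]]; rewrite /adj; apply/idP/and3P => [xy|[]//].
by have /andP[] := w _ _ xy.
Qed.

Lemma adj_induced G X x y :
  adj (induced G X) x y = rel_in (adj G) X x y.
Proof.
by rewrite /rel_in /adj !inE /=; do ![case: (_ \in _) => //=].
Qed.

Lemma wf_induced G X : wf G -> wf (induced G X).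
Proof.
move=> [s [i w]]; split=> [x y|]; first by rewrite !inE /= => /and3P[/s-> -> ->].
split=> [x|x y]; first by rewrite inE negb_and i.
by rewrite !inE /= => /and3P[/w/andP[-> ->] -> ->].
Qed.

Lemma induced_id G : wf G -> induced G (gV G) = G.
Proof.
case: G => V E [_ [_ /= w]]; congr Graph; first exact: setIid.
by apply/setP=> -[x y]; rewrite !inE /=; case: (boolP (_ \in E)) => // /w ->.
Qed.

Lemma induced_induced G X Y : Y \subset X -> induced (induced G X) Y = induced G Y.
Proof.
move=> sYX; rewrite /induced /=; congr Graph; first by rewrite setIA (setIidPl sYX).
apply/setP=> -[x y]; rewrite !inE /=; apply: andb_id2r => /andP[xY yY].
by rewrite !(subsetP sYX) ?andbT.
Qed.

Lemma biconnectedE F : wf F -> biconnected F <-> bic (adj F) (gV F).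
Proof.
move=> wF; have sF := wf_sym wF.
have adjE : adj F =2 rel_in (adj F) (gV F).
  by move=> a b; rewrite /rel_in /adj; do ![case: (_ \in _) => //=].
have adjvE v : adj (induced F (gV F :\ v)) =2 rel_in (adj F) (gV F :\ v).
  by move=> a b; rewrite adj_induced.
split=> [[[F0 cF] nc] | [F0 cF cFv]].
  have cnF : cnx (adj F) (gV F).
    by apply/cnx_connect => // x y xF yF; rewrite -(eq_connect adjE); apply: cF.
  split=> // v; have [vF|vF] := boolP (v \in gV F); last first.
    suff -> : gV F :\ v = gV F by [].
    by apply/setP=> y; rewrite in_setD1; case: eqP => // ->; rewrite (negPf vF).
  apply/cnx_connect => // x y xF yF; rewrite -(eq_connect (adjvE v)).
  apply/negPn/negP=> ncxy; apply: nc; exists v; split=> //; exists x, y; split=> //.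
  by apply: cF; [move: xF | move: yF] => /setD1P[].
split.
  split=> // x y xF yF; rewrite /conn (eq_connect adjE).
  by have /cnx_connect := cF; apply.
move=> [v [vF [x [y [xF yF _ /negP[]]]]]]; rewrite /conn (eq_connect (adjvE v)).
by have /cnx_connect := cFv v; apply.
Qed.

Lemma biconnected_inducedE G X : wf G -> X \subset gV G ->
  biconnected (induced G X) <-> bic (adj G) X.
Proof.
move=> wG sX; have [wI e] := (biconnectedE (wf_induced X wG), setIidPl sX).
have ee : {in X &, adj (induced G X) =2 adj G}.
  by move=> x y xX yX; rewrite adj_induced /rel_in xX yX !andbT.
rewrite /= e in wI; split=> [/wI | b]; first exact: bic_eq ee.
by apply/wI; apply: bic_eq b => x y xX yX; rewrite ee.
Qed.

Lemma block_bic G X : wf G -> is_block G X -> bic (adj G) X.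
Proof. by move=> wG [sX bX _]; apply/biconnected_inducedE. Qed.

Lemma bic_in_block G X : wf G -> X \subset gV G -> bic (adj G) X ->
  exists2 Y, is_block G Y & X \subset Y.
Proof.
move=> wG sX bX; pose P (Y : {set T}) := (Y \subset gV G) && `[< bic (adj G) Y >].
have PX : P X by rewrite /P sX; apply/asboolP.
have [Y /maxsetP[/andP[sY /asboolP bY] mY] XY] := maxset_exists PX.
exists Y => //; split=> //; first exact/biconnected_inducedE.
move=> Z YZ sZ /biconnected_inducedE bZ; move: (YZ).
by rewrite (mY Z) ?properxx ?(proper_sub YZ) // /P sZ; apply/asboolP; apply: bZ.
Qed.

(** Two shared vertices make the union biconnected by [bic_setU], so the maximal set [Y] absorbs
    [X]. *)
Lemma bic_sub_block G X Y x y : wf G -> is_block G Y -> X \subset gV G ->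
  bic (adj G) X -> x != y -> x \in X -> y \in X -> x \in Y -> y \in Y -> X \subset Y.
Proof.
move=> wG bY sX bX xy xX yX xY yY; have [sY _ mY] := bY.
apply/setUidPr; apply/eqP; apply/negPn/negP => ne.
have YZ : Y \proper X :|: Y by rewrite properEneq eq_sym ne subsetUr.
have sZ : X :|: Y \subset gV G by rewrite subUset sX sY.
apply: (mY _ YZ sZ); apply/biconnected_inducedE => //.
exact: bic_setU bX (block_bic wG bY) xy xX xY yX yY.
Qed.

Lemma cnx_neighbour e X x : symmetric e -> cnx e X -> 1 < #|X| -> x \in X ->
  exists2 y, y \in X & e x y.
Proof.
move=> es cX X2 xX.
have [y yX yx] : exists2 y, y \in X & y != x.
  by move: X2; rewrite (cardsD1 x) xX ltnS => /card_gt0P[y /setD1P[]]; exists y.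
have [/existsP[z /andP[zX xz]]|/existsPn nz] := boolP [exists z in X, e x z].
  by exists z.
have noe z : z \in X -> e x z = false by move=> zX; have := nz z; rewrite zX => /negbTE.
(* Without a neighbour of [x], the indicator of [x] would be locally constant on [X] and yet
   separate [x] from [y]. *)
have := cX (pred1 x) _ x y xX yX; rewrite /= eqxx (negPf yx) => h.
suff : true = false by []; apply: h => a b aX bX; rewrite /=.
by case: eqP => [->|_]; case: eqP => [->|_] //; rewrite ?noe // es noe.
Qed.

End Connectivity.

(** * Coverings of chordal graphs *)

Section Chordal.
Variable (T : finType).
Implicit Types (F : graph T).

(** Indexing the cycle by positions [0] to [n] turns chord spans into arithmetic, ready for an
    induction on the span. The excluded pair [(0, n)] is the closing edge. *)
Lemma chordal_chord F (q : nat -> T) n : symmetric (adj F) -> irreflexive (adj F) ->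
  chordal F -> 3 <= n ->
  {in [pred i | i <= n] &, injective q} ->
  (forall i, i < n -> adj F (q i) (q i.+1)) -> adj F (q n) (q 0) ->
  exists i j, [/\ i.+1 < j, j <= n, (i, j) != (0, n) & adj F (q i) (q j)].
Proof.
move=> sF iF chF n3 qI qS qn0.
have /asboolP : `[< exists i j, [/\ i.+1 < j, j <= n, (i, j) != (0, n) &
    adj F (q i) (q j)] >]; last by [].
apply/negPn/negP => /asboolP nch.
pose s := mkseq q n.+1.
have ss : size s = n.+1 by rewrite size_mkseq.
have us : uniq s.
  rewrite map_inj_in_uniq ?iota_uniq // => i j.
  by rewrite !mem_iota !add0n !ltnS /= => *; apply: qI.
have smem i : i <= n -> q i \in s.
  by move=> lin; rewrite map_f // mem_iota add0n ltnS.
have nxt i : i < n -> next s (q i) = q i.+1.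
  move=> lin; rewrite next_nth (smem _ (ltnW lin)).
  case def: s => [|x p]; first by move: ss; rewrite def.
  have nx k : k <= n -> nth x (x :: p) k = q k.
    by move=> kn; rewrite -def nth_mkseq.
  have -> : index (q i) (x :: p) = i.
    by rewrite -(nx i) ?index_uniq -?def ?ss ?ltnS // ltnW.
  by rewrite -[RHS]nx.
have nxtn : next s (q n) = q 0.
  rewrite next_nth smem //; case def: s => [|x p]; first by move: ss; rewrite def.
  have nx k : k <= n -> nth x (x :: p) k = q k.
    by move=> kn; rewrite -def nth_mkseq.
  have -> : index (q n) (x :: p) = n.
    by rewrite -(nx n) ?index_uniq -?def ?ss ?ltnS.
  have sp : size p = n by move: ss; rewrite def => -[].
  by rewrite -(nx 0) // nth_default ?sp.
have ins x : x \in s -> exists2 i, i <= n & x = q i.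
  by case/mapP=> i; rewrite mem_iota add0n ltnS => lin ->; exists i.
apply: (chF s); first by rewrite ss ltnS.
split=> // [x /ins[i lin ->]||].
- case: (ltnP i n) => [/qS/and3P[]//|nle].
  by have -> : i = n by [apply/eqP; rewrite eqn_leq lin]; case/and3P: qn0.
- apply: cycle_from_next => // x /ins[i lin ->].
  case: (ltnP i n) => [lt|nle]; first by rewrite nxt // qS.
  by have -> : i = n; [apply/eqP; rewrite eqn_leq lin | rewrite nxtn].
- have wlg i j : i <= j -> j <= n -> adj F (q i) (q j) ->
      (q j == next s (q i)) || (q i == next s (q j)).
    rewrite leq_eqVlt => /predU1P[<- _|]; first by rewrite iF.
    rewrite leq_eqVlt => /predU1P[<- lin _|ij jn aij]; first by rewrite nxt ?eqxx.
    have [/eqP[-> ->]|ne] := boolP ((i, j) == (0, n)); first by rewrite nxtn eqxx orbT.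
    by case: nch; exists i, j.
  move=> _ _ /ins[i lin ->] /ins[j ljn ->] aij.
  by case: (leqP i j) => [/wlg->|/ltnW/wlg] //; rewrite orbC sF => ->.
Qed.
End Chordal.

(** Strong induction on the length of a walk whose ends share a label. If the walk admits no
    shortening, its labels trace a cycle of [F]; chords of that cycle would lead down to one that
    lifts to a shortcut. *)
Lemma covering_inj (T T' : finType) (e : rel T) (F : graph T') (l : T -> T') :
  symmetric (adj F) -> irreflexive (adj F) -> chordal F ->
  (forall x y, e x y -> adj F (l x) (l y)) -> symmetric e ->
  (forall u x y, e u x -> e u y -> l x = l y -> x = y) ->
  (forall u x y, e u x -> e u y -> adj F (l x) (l y) -> e x y) ->
  forall x y, connect e x y -> l x = l y -> x = y.
Proof.
move=> sF iF chF hom es linj lrefl.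
suff walk n (w : nat -> T) : (forall i, i < n -> e (w i) (w i.+1)) ->
    l (w 0) = l (w n) -> w 0 = w n.
  move=> x y /connectP[p pp ->] lxy.
  have := walk (size p) (nth x (x :: p)); rewrite /= nth_last /=.
  by apply=> // i ip; apply: (pathP x pp).
elim/ltn_ind: n w => n IHn w we lw.
have [//|nw] := eqVneq (w 0) (w n).
(* Since [w 0] and [w n] differ, the induction hypothesis excludes a shorter walk with the same
   ends; [w'] jumps from position [i] straight to [j]. *)
have shortcut i j : i.+1 < j -> j <= n -> e (w i) (w j) -> False.
  move=> ij jn eij; case/eqP: nw.
  pose w' k := if k <= i then w k else w (k + (j - i.+1)).
  have w'n : w' (n - (j - i.+1)) = w n.
    by rewrite /w' ifN; [congr w; lia | lia].
  have w'0 : w' 0 = w 0 by [].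
  rewrite -w'0 -w'n; apply: IHn; rewrite ?w'n ?w'0 //; first lia.
  move=> k kn; rewrite /w'; case: (ltngtP k i) => ki.
  - by apply: we; lia.
  - by rewrite addSn; apply: we; lia.
  - by rewrite ki (_ : i.+1 + (j - i.+1) = j) //; lia.
(* Equal labels at [i] and [j] force equal vertices, by induction on the inner walk, and then the
   loop between them can be cut out. *)
have distinct i j : i < j -> j <= n -> (i, j) != (0, n) -> l (w i) <> l (w j).
  move=> ij jn ne lij; case/eqP: nw.
  have wij : w i = w j.
    have ltn : j - i < n by move: ne; rewrite xpair_eqE; lia.
    have := IHn _ ltn (fun k => w (i + k)); rewrite addn0 subnKC 1?ltnW //.
    apply=> // k kn; rewrite addnS; apply: we; lia.
  pose w' k := if k <= i then w k else w (k + (j - i)).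
  have w'n : w' (n - (j - i)) = w n.
    rewrite /w'; case: ifP => h; last by congr w; lia.
    by rewrite (_ : n - (j - i) = i) ?wij; [congr w; lia | lia].
  have w'0 : w' 0 = w 0 by [].
  rewrite -w'0 -w'n; apply: IHn; rewrite ?w'n ?w'0 //; first lia.
  move=> k kn; rewrite /w'; case: (ltngtP k i) => ki.
  - by apply: we; lia.
  - by rewrite addSn; apply: we; lia.
  - by rewrite ki wij (_ : i.+1 + (j - i) = j.+1); [apply: we; lia | lia].
(* Induction on the span [d]. For [d = 2] the chord lifts to an edge by [lrefl]; a longer one closes
   a cycle on at least four vertices, which has a chord of smaller span. *)
have nochord d i : 2 <= d -> i + d < n -> adj F (l (w i)) (l (w (i + d))) -> False.
  elim/ltn_ind: d i => d IHd i d2 idn aid.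
  have [d3|d3] := leqP d 2.
    have ed : d = 2 by lia.
    move: aid idn; rewrite ed addn2 => aid idn; apply: (shortcut i i.+2) => //; first lia.
    by apply: (lrefl (w i.+1)) => //; [rewrite es|]; apply: we; lia.
  have inj : {in [pred k | k <= d] &, injective (fun k => l (w (i + k)))}.
    move=> k k'; rewrite !inE => kd k'd lkk'; apply/eqP; case: ltngtP => // kk'; exfalso.
      by apply: distinct lkk'; rewrite ?xpair_eqE; lia.
    by apply: distinct (esym lkk'); rewrite ?xpair_eqE; lia.
  have step k : k < d -> adj F (l (w (i + k))) (l (w (i + k.+1))).
    by move=> kd; rewrite addnS; apply/hom/we; lia.
  have [|k [k' [kk' k'd ne akk']]] := chordal_chord sF iF chF d3 inj step.
    by rewrite addn0 sF.
  have lt : k' - k < d by move: ne; rewrite xpair_eqE; lia.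
  have eq : i + k + (k' - k) = i + k' by lia.
  by apply: (IHd _ lt (i + k)); rewrite ?eq //; lia.
have n3 : 2 < n.
  case: n {IHn shortcut distinct nochord} we lw nw => [|[|[|n]]] // we lw /eqP[] //.
  - by have := hom _ _ (we 0 isT); rewrite lw iF.
  - by apply: (linj (w 1)) => //; [rewrite es|]; apply: we.
(* As [w 0] and [w n] have the same label, the last edge of the walk projects to a chord of span
   [n.-1] starting at position 0. *)
have en : n.-1.+1 = n by lia.
have := hom _ _ (we n.-1 _); rewrite en -lw sF => a0n.
by exfalso; apply: (nochord n.-1 0); rewrite ?add0n ?a0n //; lia.
Qed.

Lemma addb_eq0 (a b : bool) : (a (+) b == false) = (a == b).
Proof. by case: a b => [] []. Qed.

(* The covering lemma applied to the double cover of [F] with voltages [c]. *)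
Lemma chordal_potential (T : finType) (F : graph T) (c : T -> T -> bool) :
  symmetric (adj F) -> irreflexive (adj F) -> chordal F ->
  (forall x y, adj F x y -> c x y = c y x) ->
  (forall x y z, adj F x y -> adj F y z -> adj F x z -> c x z = c x y (+) c y z) ->
  exists p : T -> bool, forall x y, adj F x y -> p x (+) p y = c x y.
Proof.
move=> sF iF chF cs ctri.
pose e : rel (T * bool) := fun u v => adj F u.1 v.1 && (v.2 == u.2 (+) c u.1 v.1).
have es : symmetric e.
  have h u v : e u v -> e v u.
    by case/andP=> uv /eqP vE; rewrite /e sF uv -(cs _ _ uv) vE addbK eqxx.
  by move=> u v; apply/idP/idP; apply: h.
have lift b x y : connect (adj F) x y -> exists b', connect e (x, b) (y, b').
  case/connectP=> s ss ->; elim: s x b ss => [|z s IHs] x b /=; first by exists b.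
  case/andP=> xz /(IHs z (b (+) c x z))[b' h]; exists b'.
  by apply: connect_trans h; apply: connect1; rewrite /e /= xz eqxx.
(* The projection [fst] is a covering: the voltage rule on triangles is exactly what lets it reflect
   adjacency of neighbours. Hence a component of the double cover meets each fibre at most once. *)
have uni x y b b1 b2 : connect e (x, b) (y, b1) -> connect e (x, b) (y, b2) -> b1 = b2.
  move=> h1 h2; suff [] : (y, b1) = (y, b2) by [].
  apply: (@covering_inj _ _ e F fst) => //.
  - by move=> u v /andP[].
  - move=> [u bu] [v bv] [w bw]; rewrite /e /= => /andP[_ /eqP->] /andP[_ /eqP->] vw.
    by rewrite vw.
  - move=> [u bu] [v bv] [w bw]; rewrite /e /=.
    move=> /andP[uv /eqP->] /andP[uw /eqP->] vw; rewrite vw.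
    by rewrite (ctri u v w) // addbA eqxx.
  - by apply: connect_trans h2; rewrite (sym_connect_sym es).
have sc := sym_connect_sym sF.
pose r := root (adj F).
(* The potential is the level reached over [x] from level [false] over the root of its component;
   [uni] makes this level unambiguous. *)
exists (fun x => connect e (r x, false) (x, true)) => x y xy.
have rxy : r y = r x by apply/eqP; rewrite /r eq_sym root_connect // connect1.
rewrite rxy; have [b hb] : exists b, connect e (r x, false) (x, b).
  by apply: lift; rewrite sc connect_root.
have hb' : connect e (r x, false) (y, b (+) c x y).
  by apply: connect_trans hb _; apply: connect1; rewrite /e /= xy eqxx.
have val z bz : connect e (r x, false) (z, bz) ->
    connect e (r x, false) (z, true) = bz.
  case: bz => // h; apply/negP => h'.
  by have := uni _ _ _ _ _ h h'.
by rewrite (val _ _ hb) (val _ _ hb') addbA addbb.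
Qed.

(* Give an edge [za] the voltage [f a] and every other edge the voltage 0: this vanishes
   on triangles, and the resulting potential is constant on the connected set [F - z]. *)
Lemma chordal_link (T : finType) (F : graph T) (z : T) (f : T -> bool) :
  wf F -> biconnected F -> chordal F ->
  (forall a b, adj F z a -> adj F z b -> adj F a b -> f a = f b) ->
  forall a b, adj F z a -> adj F z b -> f a = f b.
Proof.
move=> wF /(biconnectedE wF)[_ _ cFv] chF fE a b za zb.
have [sF iF] := (wf_sym wF, wf_irr wF).
pose c x y := if x == z then f y else if y == z then f x else false.
have [x y xy|x y w xy yw xw|p pE] := chordal_potential (c := c) sF iF chF.
- rewrite /c; case: (x =P z) => [xz|_]; case: (y =P z) => [yz|_] //.
  by move: xy; rewrite xz yz iF.
- rewrite /c; have [xz|xz] := eqVneq x z.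
    have yz : y != z by apply: contraTneq xy => ->; rewrite xz iF.
    have wz : w != z by apply: contraTneq xw => ->; rewrite xz iF.
    by rewrite (negPf yz) (negPf wz) addbF; apply: fE; rewrite // -?xz // sF.
  have [yz|yz] := eqVneq y z.
    have wz : w != z by apply: contraTneq yw => ->; rewrite yz iF.
    rewrite (negPf wz); apply/esym/eqP; rewrite addb_eq0.
    by apply/eqP; apply: fE; rewrite // -?yz // sF.
  have [wz|wz //] := eqVneq w z.
  by apply: fE; rewrite // -?wz // sF.
have inF u v : adj F u v -> v \in gV F by case/and3P.
have nz u : adj F z u -> u \in gV F :\ z.
  move=> zu; rewrite !inE (inF _ _ zu) andbT.
  by apply: contraTneq zu => ->; rewrite iF.
have fp u : adj F z u -> f u = p z (+) p u.
  by move=> zu; rewrite pE // /c eqxx.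
rewrite !fp //; congr addb; apply: (cFv z); rewrite ?nz // => x y.
rewrite !inE => /andP[xz _] /andP[yz _] /pE; rewrite /c (negPf xz) (negPf yz).
by move/eqP; rewrite addb_eq0 => /eqP.
Qed.

(** * Gluing potentials along [S] *)

Section Sum.
Variable T : finType.
Implicit Types (G H : graph T) (S X : {set T}).

(** This is the only form in which acyclicity of the auxiliary graph enters the later arguments.
    Being constant along edges of [G[S]] amounts to being constant on its components. *)
Definition splits G H S : Prop := forall dl : T -> bool,
  {in S &, forall x y, adj G x y -> dl x = dl y} ->
  exists qG qH : T -> bool,
    [/\ forall x y, adj G x y -> qG x = qG y,
        forall x y, adj H x y -> qH x = qH y &
        {in S, forall x, qG x (+) qH x = dl x}].

(* An acyclic graph is chordal without triangles, so any voltage on it has a potential. *)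
Lemma aux_splits G H S : wf G -> wf H -> S \subset gV G -> S \subset gV H ->
  induced G S = induced H S -> acyclic (aux_sum G H S) -> splits G H S.
Proof.
move=> wG wH sSG sSH eGH ac dl dlE.
set A := aux_sum G H S in ac.
have cE x y : adj A x y = [&& aux_edge x y, x \in gV A & y \in gV A].
  by rewrite /adj inE.
have aes : symmetric (@aux_edge T) by move=> [[C|C]|C] [[C'|C']|C'].
have sA : symmetric (adj A) by move=> x y; rewrite !cE aes [(x \in _) && _]andbC.
have iA : irreflexive (adj A) by move=> [[C|C]|C]; rewrite cE.
have chA : chordal A.
  move=> s s4 [us sV cs _]; have := ac s us sV (ltnW s4).
  by rewrite cs.
(* On a component [C] of [G[S]] the function [dl] takes the single value [val C]. The voltage is
   [val C] on the edge from [C] to the [H] side and 0 on the edge to the [G] side, so the potentials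
   at the two far ends differ by [val C]. *)
pose val (C : {set T}) := [exists z in C, dl z].
pose c (u v : ({set T} + {set T}) + {set T}) := match u, v with
  | inl (inr _), inr C | inr C, inl (inr _) => val C | _, _ => false end.
have [x y _|x y z|p pE] := chordal_potential (c := c) sA iA chA.
- by case: x y => [[?|?]|?] [[?|?]|?].
(* The auxiliary graph is bipartite, so there is no triangle to check. *)
- by rewrite !cE; case: x y z => [[?|?]|?] [[?|?]|?] [[?|?]|?].
pose comp (F : graph T) x := [set y in gV F | conn F x y].
have compE (F : graph T) x y : wf F -> adj F x y -> comp F x = comp F y.
  move=> wF xy; apply/setP=> z; rewrite !inE /conn.
  by rewrite (same_connect (sym_connect_sym (wf_sym wF)) (connect1 xy)).
have comp_in (F : graph T) x : x \in gV F -> comp F x \in comps F.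
  by move=> xF; rewrite inE; apply/existsP; exists x; rewrite xF eqxx.
exists (fun x => p (inl (inl (comp G x)))), (fun x => p (inl (inr (comp H x)))).
split=> [x y xy|x y xy|x xS]; first by rewrite (compE _ _ _ wG xy).
  by rewrite (compE _ _ _ wH xy).
pose C := comp (induced G S) x.
have wI : wf (induced G S) := wf_induced S wG.
have xI : x \in gV (induced G S) by rewrite /= inE xS (subsetP sSG).
have sub (F : graph T) : wf F -> induced G S = induced F S ->
    S \subset gV F -> C \subset comp F x.
  move=> wF eF sF; apply/subsetP => y; rewrite /C eF !inE /= => /andP[/andP[yS ->] /=].
  by apply: connect_sub => a b; rewrite adj_induced => /and3P[ab _ _]; apply: connect1.
have valC : val C = dl x.
  have dC y : y \in C -> dl y = dl x.
    rewrite inE => /andP[_ /connectP[s ss ->]].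
    elim: s {xI} x xS ss {C sub y} => //= y s IHs x xS.
    rewrite adj_induced => /andP[/and3P[xy _ yS] ss].
    by rewrite (IHs y) // (dlE x y).
  apply/existsP/idP => [[y /andP[/dC->]] //|dx].
  by exists x; rewrite dx inE xI /conn connect0.
have e1 : adj A (inl (inl (comp G x))) (inr C).
  rewrite cE /= sub //= !inE !imset_f ?orbT //; first exact: comp_in.
  exact/comp_in/(subsetP sSG).
have e2 : adj A (inl (inr (comp H x))) (inr C).
  rewrite cE /= sub //= !inE !imset_f ?orbT //; first exact: comp_in.
  exact/comp_in/(subsetP sSH).
have := pE _ _ e1; have := pE _ _ e2; rewrite /= valC => <- /eqP.
by rewrite addb_eq0 => /eqP->; rewrite addbC.
Qed.

End Sum.

(** * Potentials, edge colourings and links in a sum *)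

Section Gluing.
Variables (T : finType) (G H : graph T) (S : {set T}).
Implicit Types (X Y : {set T}) (c : T -> bool) (col : T -> T -> bool).
Hypotheses (wG : wf G) (wH : wf H).
Hypotheses (dGH : [disjoint gV G :\: S & gV H :\: S]).
Hypotheses (eGH : induced G S = induced H S).

Let K := gsum G H.

Lemma adj_gsum x y : adj K x y = adj G x y || adj H x y.
Proof.
rewrite -(wf_gE _ _ wG) -(wf_gE _ _ wH) /adj !inE.
case: (boolP ((x, y) \in gE G)) => /= [|_].
  by case: wG => [_ [_ w]] /w /andP[-> ->].
by case: (boolP (_ \in gE H)) => //= [] /(proj2 (proj2 wH)) /andP[-> ->]; rewrite !orbT.
Qed.

Lemma wf_gsum : wf K.
Proof.
have [[sG [iG vG]] [sH [iH vH]]] := (wG, wH).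
split=> [x y|]; first by rewrite !inE => /orP[/sG->|/sH->]; rewrite ?orbT.
split=> [x|x y]; first by rewrite inE negb_or iG iH.
by rewrite !inE => /orP[/vG|/vH] /andP[-> ->]; rewrite ?orbT.
Qed.

Lemma in_both x : x \in gV G -> x \in gV H -> x \in S.
Proof.
move=> xG xH; apply/negPn/negP => xS.
by have /pred0P/(_ x) := dGH; rewrite /= !inE xS xG xH.
Qed.

Lemma adj_S x y : x \in S -> y \in S -> adj G x y = adj H x y.
Proof.
move=> xS yS; have := congr1 (fun F => adj F x y) eGH.
by rewrite !adj_induced /rel_in xS yS !andbT.
Qed.

Lemma adj_gV (F : graph T) x y : adj F x y -> (x \in gV F) * (y \in gV F).
Proof. by case/and3P. Qed.

Lemma adj_KG x y : x \in gV G -> y \in gV G -> adj K x y = adj G x y.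
Proof.
move=> xG yG; rewrite adj_gsum; case: (boolP (adj H x y)) => [h|]; last by rewrite orbF.
have [xH yH] := adj_gV h.
by rewrite adj_S ?h ?orbT // in_both.
Qed.

Lemma adj_KH x y : x \in gV H -> y \in gV H -> adj K x y = adj H x y.
Proof.
move=> xH yH; rewrite adj_gsum; case: (boolP (adj G x y)) => [h|] //=.
have [xG yG] := adj_gV h.
by rewrite -adj_S ?h // in_both.
Qed.

Lemma bic_KG X : X \subset gV G -> bic (adj K) X <-> bic (adj G) X.
Proof.
by move/subsetP=> sX; split; apply: bic_eq => x y /sX xG /sX yG; rewrite adj_KG.
Qed.

Lemma bic_KH X : X \subset gV H -> bic (adj K) X <-> bic (adj H) X.
Proof.
by move/subsetP=> sX; split; apply: bic_eq => x y /sX xG /sX yG; rewrite adj_KH.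
Qed.

Lemma bic_gV (F : graph T) X : wf F -> bic (adj F) X -> 1 < #|X| -> X \subset gV F.
Proof.
move=> wF [_ cX _] X2; apply/subsetP => x xX; apply/negPn/negP => nx.
have [y _] := cnx_neighbour (wf_sym wF) cX X2 xX.
by case/and3P=> _ /(negP nx).
Qed.

Hypothesis spl : splits G H S.

(** On [S] the two potentials may disagree; [splits] writes their difference as [qG] plus [qH], and
    adding these corrections makes them agree without spoiling constancy along edges. *)
Lemma glue_at v (pG pH : T -> bool) :
  (forall x y, adj G x y -> x != v -> y != v -> pG x = pG y) ->
  (forall x y, adj H x y -> x != v -> y != v -> pH x = pH y) ->
  (forall x, v \in S -> x \in S -> adj G v x -> pG x = pH x) ->
  exists p : T -> bool, [/\ forall x y, adj K x y -> x != v -> y != v -> p x = p y,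
    forall x, adj G v x -> p x = pG x & forall x, adj H v x -> p x = pH x].
Proof.
move=> hG hH hS; have [iG iH] := (wf_irr wG, wf_irr wH).
have ne x : adj G v x || adj H v x -> x != v.
  by apply: contraTneq => ->; rewrite iG iH.
(* The difference is set to 0 at [v]; hypothesis [hS] keeps it constant along edges of [G[S]] at
   [v]. *)
have [|qG [qH [qGE qHE qE]]] := spl (dl := fun x => (x != v) && (pG x (+) pH x)).
  move=> x y xS yS xy; have [xv|xv] := eqVneq x v.
    move: xy xS; rewrite xv => vy vS; have -> := hS _ vS yS vy.
    by rewrite addbb andbF.
  have [yv|yv] := eqVneq y v.
    move: xy yS; rewrite yv (wf_sym wG) => vx vS; have -> := hS _ vS xS vx.
    by rewrite addbb.
  by rewrite /= (hG x y) // (hH x y) // -adj_S.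
(* [k] is the correction at [v], common to both sides if [v] lies in both. Adding it again cancels
   the correction at every neighbour of [v]. *)
pose k := if v \in gV G then qG v else qH v.
have kH x : adj H v x -> qH v = k.
  move=> /adj_gV[vH _]; rewrite /k; case: ifP => // vG.
  have := qE v (in_both vG vH); rewrite eqxx => /eqP.
  by rewrite addb_eq0 => /eqP.
pose p x := if x \in gV G then pG x (+) qG x (+) k else pH x (+) qH x (+) k.
have pH_ x : x \in gV H -> x != v -> p x = pH x (+) qH x (+) k.
  move=> xH xv; rewrite /p; case: ifP => // xG.
  have := qE x (in_both xG xH); rewrite xv /= => e; congr addb.
  by move: e; case: (pG x) (qG x) (pH x) (qH x) => [] [] [] [].
exists p; split=> [x y|x vx|x vx].
- rewrite adj_gsum => /orP[xy|xy] xv yv; have [xF yF] := adj_gV xy.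
    by rewrite /p xF yF (hG x y) // (qGE x y).
  by rewrite !pH_ // (hH x y) // (qHE x y).
- have [vF xF] := adj_gV vx.
  by rewrite /p xF /k vF (qGE v x) // -addbA addbb addbF.
- have [vF xF] := adj_gV vx.
  by rewrite pH_ ?ne ?vx ?orbT // -(kH x vx) (qHE v x) // -addbA addbb addbF.
Qed.

(** Two neighbours of [v] in one component of [F - v] lie in a common biconnected set, by
    [bic_neighbours]. So [c] takes one value per component and extends over it. *)
Lemma local_potential (F : graph T) v c : wf F ->
  (forall Y, bic (adj F) Y -> v \in Y ->
     {in Y &, forall a b, adj F v a -> adj F v b -> c a = c b}) ->
  exists p : T -> bool,
    (forall x y, adj F x y -> x != v -> y != v -> p x = p y) /\
    (forall x, adj F v x -> p x = c x).
Proof.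
move=> wF cE; have [sF iF] := (wf_sym wF, wf_irr wF).
pose r := fun x y => [&& adj F x y, x != v & y != v].
have rs : connect_sym r.
  by apply: sym_connect_sym => a b; rewrite /r sF [(a != v) && _]andbC.
exists (fun x => [exists a, [&& adj F v a, c a & connect r a x]]); split.
  move=> x y xy xv yv; apply: eq_existsb => a; congr [&& _, _ & _].
  by apply: same_connect_r => //; apply: connect1; rewrite /r xy xv.
move=> x vx; apply/existsP/idP => [[a /and3P[va ca ax]]|cx]; last first.
  by exists x; rewrite vx cx connect0.
have [Y [bY vY aY xY]] := bic_neighbours sF iF va vx ax.
by rewrite -(cE Y bY vY a x).
Qed.

(** The potentials for [c] on [G - v] and [H - v] glue to one on [K - v], which is constant on the
    connected set [X :\ v]. *)
Lemma local_glue v c :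
  (forall Y, bic (adj G) Y -> v \in Y ->
     {in Y &, forall a b, adj G v a -> adj G v b -> c a = c b}) ->
  (forall Y, bic (adj H) Y -> v \in Y ->
     {in Y &, forall a b, adj H v a -> adj H v b -> c a = c b}) ->
  forall X, bic (adj K) X -> v \in X ->
    {in X &, forall a b, adj K v a -> adj K v b -> c a = c b}.
Proof.
move=> /(local_potential wG)[pG [pGE pGc]] /(local_potential wH)[pH [pHE pHc]].
move=> X [_ _ /(_ v) cX] vX a b aX bX va vb.
have [|p [pE pvG pvH]] := glue_at pGE pHE.
  by move=> x vS xS vx; rewrite pGc // pHc // -adj_S.
have ne x : adj K v x -> x != v by apply: contraTneq => ->; rewrite (wf_irr wf_gsum).
have pc x : adj K v x -> p x = c x.
  by rewrite adj_gsum => /orP[h|h]; [rewrite pvG ?pGc | rewrite pvH ?pHc].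
rewrite -!pc //; apply: cX; rewrite ?inE ?ne // => x y /setD1P[xv _] /setD1P[yv _] xy.
exact: pE.
Qed.

Lemma colour_glue col : (forall x y, col x y = col y x) ->
  (forall Y, bic (adj G) Y -> {in Y & &, forall v a b,
     adj G v a -> adj G v b -> col v a = col v b}) ->
  (forall Y, bic (adj H) Y -> {in Y & &, forall v a b,
     adj H v a -> adj H v b -> col v a = col v b}) ->
  forall X, bic (adj K) X -> {in X &, forall x y, adj K x y -> col x y ->
    {in X &, forall x' y', adj K x' y' -> col x' y'}}.
Proof.
move=> cs cG cH X bX x y xX yX xy cxy x' y' x'X y'X x'y'.
have sK := wf_sym wf_gsum.
have loc v a b : v \in X -> a \in X -> b \in X -> adj K v a -> adj K v b -> col v a = col v b.
  move=> vX aX bX'; apply: (@local_glue v (col v)) bX vX _ _ aX bX'.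
    by move=> Y bY vY a' b' a'Y b'Y; apply: (cG Y).
  by move=> Y bY vY a' b' a'Y b'Y; apply: (cH Y).
(* By [local_glue] all edges of [X] at [v] have one colour, recorded by [f v]. The ends of an edge
   share its colour, so [f] is constant on the connected set [X]. *)
pose f v := [exists a in X, adj K v a && col v a].
have fE v a : v \in X -> a \in X -> adj K v a -> f v = col v a.
  move=> vX aX va; apply/existsP/idP => [[b /and3P[bX' vb cvb]]|cva].
    by rewrite (loc v a b).
  by exists a; rewrite aX va.
have [_ cX _] := bX.
rewrite -(fE _ y') // -(cX f _ x x') ?(fE x y) // => a b aX bX' ab.
by rewrite (fE a b) // (fE b a) 1?sK // cs.
Qed.

(** Let [Y] be the block of [G] containing the edge [ab], and colour an edge by whether both ends
    are in [Y]. An edge of [H] with this colour would lie inside [S], which is excluded; so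
    [colour_glue] forces [X] into [Y]. *)
Lemma block_on_side X a b : is_block K X ->
  {in X :&: S &, forall x y, ~~ adj G x y} ->
  a \in X -> b \in X -> adj G a b -> X \subset gV G.
Proof.
move=> bX nS aX bX' ab; have [sG iG] := (wf_sym wG, wf_irr wG).
have ne x y : adj G x y -> x != y by apply: contraTneq => ->; rewrite iG.
have bab := bic_edge sG (ne _ _ ab) ab.
have bG Z x y : bic (adj G) Z -> x \in Z -> y \in Z -> x != y -> Z \subset gV G.
  move=> bZ xZ yZ xy; apply: bic_gV => //; apply/card_gt1P; by exists x, y.
have [Y bY] := bic_in_block wG (bG _ _ _ bab (set21 a b) (set22 a b) (ne _ _ ab)) bab.
rewrite subUset !sub1set => /andP[aY bY'].
have sYG : Y \subset gV G by case: bY.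
have sYX : Y \subset X.
  apply: (bic_sub_block wf_gsum bX _ _ (ne _ _ ab)) => //.
    exact: subset_trans sYG (subsetUl _ _).
  by apply/bic_KG => //; apply: block_bic.
pose col x y := (x \in Y) && (y \in Y).
have colX : {in X &, forall x y, adj K x y -> col x y}.
  apply: (@colour_glue col _ _ _ X _ a b) => //; rewrite ?/col ?aY //.
  - by move=> x y; rewrite andbC.
  - move=> Z bZ v x y vZ xZ yZ vx vy.
    have h p q : p \in Z -> q \in Z -> adj G p q -> p \in Y -> q \in Y -> Z \subset Y.
      move=> pZ qZ pq pY qY; apply: (bic_sub_block wG bY _ bZ (ne _ _ pq)) => //.
      exact: bG (ne _ _ pq).
    apply/andP/andP => -[vY oY].
      by have /subsetP sZ := h _ _ vZ xZ vx vY oY; rewrite !sZ.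
    by have /subsetP sZ := h _ _ vZ yZ vy vY oY; rewrite !sZ.
  - move=> Z bZ v x y vZ xZ yZ.
    have h p q : adj H p q -> (p \in Y) && (q \in Y) = false.
      move=> pq; apply/negP => /andP[pY qY]; have [pH qH] := adj_gV pq.
      have [pS qS] := (in_both (subsetP sYG _ pY) pH, in_both (subsetP sYG _ qY) qH).
      by have := nS p q; rewrite !inE !(subsetP sYX) // adj_S // pq pS qS => /(_ isT isT).
    by move=> /h-> /h->.
  - exact: block_bic wf_gsum bX.
  - by rewrite adj_gsum ab.
apply: subset_trans sYG; apply/subsetP => x xX.
have [_ cX _] := block_bic wf_gsum bX.
suff -> : (x \in Y) = (a \in Y) by [].
apply: (cX (fun z => z \in Y)) => // p q pX qX pq.
by have /andP[-> ->] := colX p q pX qX pq.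
Qed.

(** The block [Z] of [G] around [Y] is either inside [X], where [chordal_link] applies, or shares no
    edge at [w] with [X], and then both sides are false. *)
Lemma link_side X w (f : T -> bool) : is_block K X -> w \in X ->
  (forall Y, is_block G Y -> chordal (induced G Y)) ->
  {in [set x in X | adj K w x] &, forall x y, adj K x y -> f x = f y} ->
  forall Y, bic (adj G) Y -> w \in Y -> {in Y &, forall a b,
    adj G w a -> adj G w b -> (a \in X) && f a = (b \in X) && f b}.
Proof.
move=> bX wX ch fE Y bY wY a b aY bY' wa wb.
have ne x : adj G w x -> w != x by apply: contraTneq => ->; rewrite (wf_irr wG).
have sY : Y \subset gV G.
  by apply: bic_gV => //; apply/card_gt1P; exists w, a; split; rewrite ?ne.
have [Z bZ /subsetP sYZ] := bic_in_block wG sY bY; have [sZG bcZ _] := bZ.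
have ZX x : x \in Z -> x \in X -> adj G w x -> Z \subset X.
  move=> xZ xX wx; apply: (bic_sub_block wf_gsum bX _ _ (ne _ wx)) => //; last exact: sYZ.
    exact: subset_trans sZG (subsetUl _ _).
  by apply/bic_KG => //; apply: block_bic.
have [/subsetP sZX|nZX] := boolP (Z \subset X); last first.
  have out x : x \in Y -> adj G w x -> x \in X = false.
    by move=> /sYZ xZ wx; apply: contraNF nZX => xX; apply: (ZX x).
  by rewrite !out.
have adjZ x y : adj (induced G Z) x y = rel_in (adj G) Z x y := adj_induced G Z x y.
rewrite !sZX ?sYZ //=.
apply: (chordal_link (z := w) (wf_induced Z wG) bcZ (ch _ bZ)).
- move=> x y; rewrite !adjZ => /and3P[wx _ xZ] /and3P[wy _ yZ] /and3P[xy _ _].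
  by apply: fE; rewrite ?inE ?sZX // adj_gsum ?wx ?wy ?xy.
- by rewrite adjZ /rel_in wa !sYZ.
- by rewrite adjZ /rel_in wb !sYZ.
Qed.

End Gluing.

Lemma gsumC (T : finType) (G H : graph T) : gsum G H = gsum H G.
Proof. by congr Graph; apply: setUC. Qed.

Lemma splitsC (T : finType) (G H : graph T) S :
  induced G S = induced H S -> splits G H S -> splits H G S.
Proof.
move=> eGH spl dl dlE.
have [x y xS yS xy|qG [qH [hG hH hE]]] := spl dl.
  by apply: dlE => //; rewrite -(adj_S eGH).
by exists qH, qG; split=> // x xS; rewrite addbC hE.
Qed.


(** A locally constant [f] on the link is cut off by membership in [X], because [local_glue] needs
    constancy on every biconnected set through [w], including those leaving [X]. *)
Lemma link_glue (T : finType) (G H : graph T) (S X : {set T}) w : wf G -> wf H ->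
  [disjoint gV G :\: S & gV H :\: S] -> induced G S = induced H S -> splits G H S ->
  (forall Y, is_block G Y -> chordal (induced G Y)) ->
  (forall Y, is_block H Y -> chordal (induced H Y)) ->
  is_block (gsum G H) X -> w \in X ->
  cnx (adj (gsum G H)) [set x in X | adj (gsum G H) w x].
Proof.
move=> wG wH dGH eGH spl chG chH bX wX f fE a b; rewrite !inE => /andP[aX wa] /andP[bX' wb].
suff: (a \in X) && f a = (b \in X) && f b by rewrite aX bX'.
have bicX := block_bic (wf_gsum wG wH) bX.
apply: (local_glue (c := fun x => (x \in X) && f x) wG wH dGH eGH spl
  _ _ bicX wX aX bX' wa wb).
  exact: (link_side wG wH dGH eGH bX wX chG fE).
have dHG : [disjoint gV H :\: S & gV G :\: S] by rewrite disjoint_sym.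
move: bX fE; rewrite gsumC => bX fE.
exact: (link_side wH wG dHG (esym eGH) bX wX chH fE).
Qed.

(** * From local bijectivity to isomorphism *)

(** Injectivity is [covering_inj] inside [D]. The image is closed under adjacency in [E] by [lsur],
    hence all of the connected set [E]; an edge of the image lifts at one end, and injectivity
    identifies the other end. *)
Lemma covering_iso (T T' : finType) (e : rel T) (D : {set T}) (F : graph T')
    (E : {set T'}) (l : T -> T') :
  wf F -> chordal F -> symmetric e -> D != set0 -> cnx e D -> cnx (adj F) E ->
  {in D, forall x, l x \in E} ->
  {in D &, forall x y, e x y -> adj F (l x) (l y)} ->
  {in D & &, forall u x y, e u x -> e u y -> l x = l y -> x = y} ->
  {in D & &, forall u x y, e u x -> e u y -> adj F (l x) (l y) -> e x y} ->
  {in D & E, forall u z, adj F (l u) z -> exists x, [/\ x \in D, e u x & l x = z]} ->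
  [/\ {in D &, injective l}, l @: D = E &
      {in D &, forall x y, adj F (l x) (l y) = e x y}].
Proof.
move=> wF chF es D0 cD cE lE hom linj lrefl lsur; have [sF iF] := (wf_sym wF, wf_irr wF).
have inj : {in D &, injective l}.
  move=> x y xD yD; apply: (@covering_inj _ _ (rel_in e D) F l) => //.
  - by move=> a b /and3P[ab aD bD]; apply: hom.
  - by move=> a b; rewrite /rel_in es [(a \in D) && _]andbC.
  - by move=> u a b /and3P[ua uD aD] /and3P[ub _ bD]; apply: (linj u).
  - move=> u a b /and3P[ua uD aD] /and3P[ub _ bD] ab.
    by rewrite /rel_in aD bD (lrefl u).
  - by have /(cnx_connect _ es) := cD; apply.
split=> // [|x y xD yD].
  apply/eqP; rewrite eqEsubset; apply/andP; split.
    by apply/subsetP => _ /imsetP[x xD ->]; apply: lE.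
  have /set0Pn[x xD] := D0; apply/subsetP => z zE.
  suff -> : (z \in l @: D) = (l x \in l @: D) by apply: imset_f.
  have lift a b : a \in E -> b \in E -> adj F a b -> a \in l @: D -> b \in l @: D.
    move=> aE bE ab /imsetP[u uD au]; move: ab; rewrite au => /(lsur u b uD bE).
    by case=> y [yD _ <-]; apply: imset_f.
  apply: (cE (fun z => z \in l @: D)) => // [a b aE bE ab|]; last exact: lE.
  by apply/idP/idP; apply: lift; rewrite // sF.
apply/idP/idP => [a|]; last exact: hom.
have [y' [y'D xy' /inj <-//]] := lsur x (l y) xD (lE y yD) a.
Qed.

(* A map that is bijective on the common neighbourhoods of the ends of edges
   covers connected links, hence vertex neighbourhoods, hence the whole chordal graph. *)
Lemma link_covering_iso (T T' : finType) (e : rel T) (X : {set T}) (F : graph T')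
    (l : T -> T') :
  wf F -> biconnected F -> chordal F -> symmetric e ->
  cnx e X -> 1 < #|X| ->
  (forall w, w \in X -> cnx e [set x in X | e w x]) ->
  {in X &, forall x y, e x y -> adj F (l x) (l y)} ->
  (forall w u, w \in X -> u \in X -> e w u ->
     let N := [set x in X | e w x && e u x] in
     [/\ {in N &, injective l}, {in N &, forall x y, adj F (l x) (l y) -> e x y} &
         forall z, adj F (l w) z -> adj F (l u) z -> exists2 x, x \in N & l x = z]) ->
  [/\ {in X &, injective l}, l @: X = gV F &
      {in X &, forall x y, adj F (l x) (l y) = e x y}].
Proof.
move=> wF bF chF es cX X2 cN hom elink; have [sF iF] := (wf_sym wF, wf_irr wF).
have nb x : x \in X -> exists2 y, y \in X & e x y by apply: cnx_neighbour.
have vlink w : w \in X -> let N := [set x in X | e w x] in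
    [/\ {in N &, injective l}, l @: N = [set z | adj F (l w) z] &
      {in N &, forall x y, adj F (l x) (l y) = e x y}].
  move=> wX; apply: covering_iso => //.
  - by have [y yX wy] := nb w wX; apply/set0Pn; exists y; rewrite inE yX.
  - exact: cN.
  - move=> f fE a b; rewrite !inE => wa wb.
    by apply: (chordal_link wF bF chF) wa wb => x y wx wy xy; apply: fE; rewrite ?inE.
  - by move=> x; rewrite !inE => /andP[xX wx]; apply: hom.
  - by move=> x y; rewrite !inE => /andP[xX _] /andP[yX _]; apply: hom.
  - move=> u x y; rewrite !inE => /andP[uX wu] /andP[xX wx] /andP[yX wy] ux uy.
    have [inj _ _] := elink w u wX uX wu.
    by apply: inj; rewrite inE ?xX ?yX ?wx ?wy.
  - move=> u x y; rewrite !inE => /andP[uX wu] /andP[xX wx] /andP[yX wy] ux uy.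
    have [_ rf _] := elink w u wX uX wu.
    by apply: rf; rewrite inE ?xX ?yX ?wx ?wy.
  - move=> u z; rewrite !inE => /andP[uX wu] wz uz.
    have [_ _ /(_ z wz uz)[x]] := elink w u wX uX wu.
    by rewrite !inE => /and3P[xX wx ux] xz; exists x; rewrite inE xX.
have /(biconnectedE wF)[_ cF _] := bF.
apply: covering_iso => //.
- by rewrite -card_gt0 ltnW.
- by move=> x xX; have [y yX /(hom _ _ xX yX)/and3P[]] := nb x xX.
- move=> u x y uX xX yX ux uy; have [inj _ _] := vlink u uX.
  by apply: inj; rewrite inE ?xX ?yX.
- move=> u x y uX xX yX ux uy; have [_ _ rf] := vlink u uX.
  by rewrite rf ?inE ?xX ?yX.
- move=> u z uX _ uz; have [_ im _] := vlink u uX.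
  have : z \in l @: [set x in X | e u x] by rewrite im inE.
  by case/imsetP=> x; rewrite inE => /andP[xX ux] ->; exists x.
Qed.

(** * Label-isomorphisms read off from the labels *)

Section Liso.
Variables (T : finType) (d : nat).
Implicit Types (G : graph T) (L : T -> 'I_d) (Q : graph 'I_d) (Y : {set T}).

(** A target labelled by the identity leaves no choice: the isomorphism is the labelling itself. *)
Lemma lisoP G L Q Y : wf G -> wf Q -> Y \subset gV G ->
  liso (induced G Y) L Q id <->
  [/\ {in Y &, injective L}, L @: Y = gV Q &
      {in Y &, forall x y, adj Q (L x) (L y) = adj G x y}].
Proof.
move=> wG wQ sY; rewrite /liso /= (setIidPl sY).
have gE_ind x y : x \in Y -> y \in Y -> ((x, y) \in gE (induced G Y)) = adj G x y.
  by move=> xY yY; rewrite -(wf_gE _ _ wG) !inE xY yY !andbT.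
split=> [[f [inj im ee fL]]|[inj im ee]].
  split=> [x y xY yY|| x y xY yY].
  - by rewrite -!fL // => /(inj _ _ xY yY).
  - by rewrite -im; apply: eq_in_imset => x xY; rewrite -fL.
  - by rewrite -(wf_gE _ _ wQ) -!fL // ee // gE_ind.
by exists L; split=> // x y xY yY; rewrite wf_gE // ee // gE_ind.
Qed.

Lemma partial_lisoE G L Q Y : wf G -> wf Q -> Y \subset gV G ->
  partial_liso (induced G Y) L Q ->
  {in Y &, injective L} /\ {in Y &, forall x y, adj Q (L x) (L y) = adj G x y}.
Proof.
move=> wG wQ sY; rewrite /partial_liso /= (setIidPl sY).
move=> /(lisoP _ wG (wf_induced _ wQ) sY)[inj _ ee]; split=> // x y xY yY.
by rewrite -ee // adj_induced /rel_in !imset_f // !andbT.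
Qed.

(** Both targets live on labels, so being copies of the same labelled graph makes them equal and not
    merely isomorphic. *)
Lemma liso_graph_eq G L Q Q' Y : wf G -> wf Q -> wf Q' -> Y \subset gV G ->
  liso (induced G Y) L Q id -> liso (induced G Y) L Q' id -> Q = Q'.
Proof.
move=> wG wQ wQ' sY /(lisoP _ wG wQ sY)[_ im ee] /(lisoP _ wG wQ' sY)[_ im' ee'].
suff adjE : adj Q =2 adj Q'.
  case: Q Q' => V E [V' E'] in wQ wQ' im im' ee ee' adjE *.
  congr Graph; first by rewrite -[LHS]im.
  by apply/setP => -[x y]; rewrite (wf_gE x y wQ) adjE -(wf_gE x y wQ').
move=> x y; have [/andP[]|nxy] := boolP ((x \in L @: Y) && (y \in L @: Y)).
  by move=> /imsetP[a aY ->] /imsetP[b bY ->]; rewrite ee // ee'.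
have h F : L @: Y = gV F -> adj F x y = false.
  by move=> eF; apply: contraNF nxy; rewrite eF => /and3P[_ -> ->].
by rewrite !h.
Qed.

End Liso.

Lemma iso_sym (T1 T2 : finType) (G1 : graph T1) (G2 : graph T2) :
  gV G1 != set0 -> iso G1 G2 -> iso G2 G1.
Proof.
move=> /set0Pn[x0 x0G] [f [inj im ee]].
(* [x0] is a default value for [y] outside the vertices of [G2]. *)
pose k y := if [pick x in gV G1 | f x == y] is Some x then x else x0.
have kP y : y \in gV G2 -> (k y \in gV G1) /\ f (k y) = y.
  rewrite -im => /imsetP[x xG ->]; rewrite /k; case: pickP => [z /andP[? /eqP]//|].
  by move/(_ x); rewrite xG eqxx.
have fG x : x \in gV G1 -> f x \in gV G2 by rewrite -im => /(imset_f f).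
exists k; split=> [x y xG yG kxy||x y xG yG].
- by have [[_ <-] [_ <-]] := (kP x xG, kP y yG); rewrite kxy.
- apply/setP => x; apply/imsetP/idP => [[y /kP[yG _] ->] //|xG].
  exists (f x); first exact: fG.
  by have [kG kf] := kP _ (fG x xG); apply: inj.
- by have [[kx fx] [ky fy]] := (kP x xG, kP y yG); rewrite -ee // fx fy.
Qed.

Lemma lsum_l (d : nat) (T : finType) (G : graph T) (LG LH : T -> 'I_d) x :
  x \in gV G -> lsum G LG LH x = LG x.
Proof. by rewrite /lsum => ->. Qed.

Lemma lsum_r (d : nat) (T : finType) (G H : graph T) (LG LH : T -> 'I_d) S x :
  compatible G LG H LH S -> x \in gV H -> lsum G LG LH x = LH x.
Proof.
by move=> [dGH _ lE] xH; rewrite /lsum; case: ifP => // xG; rewrite lE // (in_both dGH).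
Qed.

Lemma BlockSE (T : finType) (F : graph T) (S B : {set T}) : wf F -> BlockS F S B ->
  [/\ B \subset S, B \subset gV F, bic (adj F) B & 1 < #|B|].
Proof.
move=> wF [bB B2]; have [] := bB; rewrite subsetI => /andP[sS sF] _ _; split=> //.
apply: bic_eq (block_bic (wf_induced S wF) bB) => x y xB yB.
by rewrite adj_induced /rel_in !(subsetP sS) // !andbT.
Qed.

Lemma edge_BlockS (T : finType) (F : graph T) (S : {set T}) a b : wf F ->
  a \in S -> b \in S -> adj F a b -> exists B, [/\ BlockS F S B, a \in B & b \in B].
Proof.
move=> wF aS bS ab; have wI := wf_induced S wF.
have ne : a != b by apply: contraTneq ab => ->; rewrite (wf_irr wF).
have abI : adj (induced F S) a b by rewrite adj_induced /rel_in ab aS bS.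
have bab := bic_edge (wf_sym wI) ne abI.
have [|B bB] := bic_in_block wI _ bab.
  by apply: bic_gV; rewrite // cards2 ne.
rewrite subUset !sub1set => /andP[aB bB']; exists B; split=> //; split=> //.
by apply/card_gt1P; exists a, b.
Qed.

(** A biconnected graph is a block of itself. *)
Lemma Ud_class (P : gclass) (d : nat) (Q : graph 'I_d) :
  Ud P Q -> P 'I_d Q.
Proof.
move=> [wQ [bQ pQ]]; rewrite -(induced_id wQ); apply: pQ.
split=> // [|Y gY sY]; first by rewrite induced_id.
by have := proper_sub_trans gY sY; rewrite properxx.
Qed.

(** * Blocks of the second sum that contain an element of [Block(G2, S)] *)

Section Exchange.
Variables (d : nat) (P : gclass) (T : finType) (G1 G2 H : graph T) (S : {set T}).
Variables (L1 L2 LH : T -> 'I_d).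
Variables (g : {set T} -> graph 'I_d) (h : {set T} -> {set 'I_d}).
Hypothesis Pch : chordal_class P.
Hypotheses (wG1 : wf G1) (wG2 : wf G2) (wH : wf H).
Hypotheses (PG2 : Pblock P G2) (PH : Pblock P H).
Hypotheses (c1 : compatible G1 L1 H LH S) (c2 : compatible G2 L2 H LH S).
Hypotheses (ch1 : characteristic P G1 S L1 g h) (ch2 : characteristic P G2 S L2 g h).
Hypotheses (spl : splits G2 H S) (resp : respects G1 S L1 H LH g).

Let K1 := gsum G1 H.
Let K2 := gsum G2 H.
Let l1 := lsum G1 L1 LH.
Let l2 := lsum G2 L2 LH.
Let wK1 : wf K1 := wf_gsum wG1 wH.
Let wK2 : wf K2 := wf_gsum wG2 wH.
Let d1 : [disjoint gV G1 :\: S & gV H :\: S] .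
Proof. by case: c1. Qed.
Let d2 : [disjoint gV G2 :\: S & gV H :\: S] .
Proof. by case: c2. Qed.
Let e1 : induced G1 S = induced H S .
Proof. by case: c1. Qed.
Let e2 : induced G2 S = induced H S .
Proof. by case: c2. Qed.

Let BlockS1 B : BlockS G2 S B -> BlockS G1 S B.
Proof. by rewrite /BlockS e1 e2. Qed.

Let BlockSH B : BlockS G2 S B -> BlockS H S B.
Proof. by rewrite /BlockS e2. Qed.

Let wg B : BlockS G2 S B -> wf (g B).
Proof. by case/ch2=> -[]. Qed.

Lemma gG_const Y B B' : is_block G2 Y -> BlockS G2 S B -> BlockS G2 S B' ->
  B \subset Y -> B' \subset Y -> g B' = g B.
Proof. by move=> bY /ch2[_ /(_ Y bY) hB] sB' BY B'Y; have [_ ->] := hB BY. Qed.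

(** [H] comes without a characteristic, so its blocks are compared with [g B] through the block of
    the first sum that contains them. *)
Lemma H_block_in_K1 Z B : is_block H Z -> BlockS G2 S B -> B \subset Z ->
  exists X1, [/\ is_block K1 X1, Z \subset X1, {in X1 &, injective l1},
    l1 @: X1 = gV (g B) &
    {in X1 &, forall x y, adj (g B) (l1 x) (l1 y) = adj K1 x y}].
Proof.
move=> bZ sB BZ; have [sZ _ _] := bZ.
have bZK : bic (adj K1) Z by apply/(bic_KH wG1 wH d1 e1 sZ); apply: block_bic.
have [X1 bX1 ZX] := bic_in_block wK1 (subset_trans sZ (subsetUr _ _)) bZK.
have BX := subset_trans BZ ZX; have [sX _ _] := bX1.
have /(lisoP _ wK1 (wg sB) sX)[inj im ee] := resp (BlockS1 sB) bX1 BX.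
by exists X1.
Qed.

(** The counterpart of clause (b) for [H]: one block of the first sum is label-isomorphic to both
    graphs, so [liso_graph_eq] applies. *)
Lemma gH_const Z B B' : is_block H Z -> BlockS G2 S B -> BlockS G2 S B' ->
  B \subset Z -> B' \subset Z -> g B' = g B.
Proof.
move=> bZ sB sB' BZ B'Z; have [X1 [bX ZX _ _ _]] := H_block_in_K1 bZ sB BZ.
have [sX _ _] := bX.
apply: (liso_graph_eq wK1 (wg sB') (wg sB) sX).
  by apply: (resp (BlockS1 sB') bX); apply: subset_trans ZX.
by apply: (resp (BlockS1 sB) bX); apply: subset_trans ZX.
Qed.

Variables (X B0 : {set T}).
Hypotheses (bX : is_block K2 X) (sB0 : BlockS G2 S B0) (B0X : B0 \subset X).
Let Q := g B0.
Let wQ : wf Q := wg sB0.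
Let UQ : Ud P Q := proj1 (ch2 sB0).

(** Used with [F] equal to [G2] or [H]. By [gG_const] and [gH_const] the value [Q] does not depend
    on which [B] inside [Y] is taken. *)
Definition carries (F : graph T) (Y : {set T}) : Prop :=
  is_block F Y /\ exists B, [/\ BlockS G2 S B, B \subset Y & g B = Q].

Let ne (F : graph T) x y : wf F -> adj F x y -> x != y.
Proof. by move=> wF; apply: contraTneq => ->; rewrite (wf_irr wF). Qed.

Let adj_subX (F : graph T) (Y : {set T}) x y : wf F -> is_block F Y -> gV F \subset gV K2 ->
  (forall Z : {set T}, Z \subset gV F -> bic (adj F) Z -> bic (adj K2) Z) ->
  adj F x y -> x \in X -> y \in X -> x \in Y -> y \in Y -> Y \subset X.
Proof.
move=> wF bY sF lift xy xX yX xY yY; have [sY _ _] := bY.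
apply: (bic_sub_block wK2 bX _ _ (ne wF xy)) => //; first exact: subset_trans sF.
by apply: lift => //; apply: block_bic.
Qed.

Let subX_G (Y : {set T}) x y : is_block G2 Y -> adj G2 x y ->
  x \in X -> y \in X -> x \in Y -> y \in Y -> Y \subset X.
Proof.
move=> bY; apply: adj_subX => //; first exact: subsetUl.
by move=> Z sZ; move/(bic_KG wG2 wH d2 e2 sZ).
Qed.

Let subX_H (Y : {set T}) x y : is_block H Y -> adj H x y ->
  x \in X -> y \in X -> x \in Y -> y \in Y -> Y \subset X.
Proof.
move=> bY; apply: adj_subX => //; first exact: subsetUr.
by move=> Z sZ; move/(bic_KH wG2 wH d2 e2 sZ).
Qed.

Let S_edge (F : graph T) (Y : {set T}) x y B : wf F ->
  induced G2 S = induced F S -> is_block F Y ->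
  x \in S -> y \in S -> adj G2 x y -> x \in Y -> y \in Y ->
  BlockS G2 S B -> x \in B -> y \in B -> B \subset Y.
Proof.
move=> wF eF bY xS yS xy xY yY sB xB yB.
have sBF : BlockS F S B by rewrite /BlockS -eF.
have [_ sF bB _] := BlockSE wF sBF.
exact: (bic_sub_block wF bY sF bB (ne wG2 xy)).
Qed.

(** An edge inside [S] lies in some [B'] of [Block(G2, S)], which sits inside [Y] and so has value
    [Q]; any block of [F'] around [B'] then carries [Q] too. *)
Lemma carries_transfer (F F' : graph T) (Y : {set T}) x y : wf F -> wf F' ->
  induced G2 S = induced F S -> induced G2 S = induced F' S ->
  (forall B B' : {set T}, BlockS G2 S B -> BlockS G2 S B' -> B \subset Y -> B' \subset Y ->
     g B' = g B) ->
  x \in S -> y \in S -> adj G2 x y -> x \in Y -> y \in Y -> carries F Y ->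
  exists Z : {set T}, [/\ carries F' Z, x \in Z & y \in Z].
Proof.
move=> wF wF' eF eF' gc xS yS xy xY yY [bY [B [sB BY gB]]].
have [B' [sB' xB' yB']] := edge_BlockS wG2 xS yS xy.
have B'Y := S_edge wF eF bY xS yS xy xY yY sB' xB' yB'.
have sB'F : BlockS F' S B' by rewrite /BlockS -eF'.
have [_ sF' bB' _] := BlockSE wF' sB'F.
have [Z bZ BZ] := bic_in_block wF' sF' bB'.
exists Z; rewrite !(subsetP BZ) //; split=> //; split=> //.
by exists B'; split=> //; rewrite -gB; apply: gc.
Qed.

Lemma G_carries x y (Y : {set T}) : x \in Y -> y \in Y -> adj G2 x y -> carries H Y ->
  exists Z : {set T}, [/\ carries G2 Z, x \in Z & y \in Z].
Proof.
move=> xY yY xy cY; have [bY _] := cY; have [/subsetP sY _ _] := bY.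
have [xG yG] := adj_gV xy.
have [xS yS] := (in_both d2 xG (sY _ xY), in_both d2 yG (sY _ yY)).
by apply: (carries_transfer wH wG2 e2 _ _ xS yS xy xY yY cY) => // B B'; apply: gH_const.
Qed.

Lemma H_carries x y (Y : {set T}) : x \in Y -> y \in Y -> adj H x y -> carries G2 Y ->
  exists Z : {set T}, [/\ carries H Z, x \in Z & y \in Z].
Proof.
move=> xY yY xy cY; have [bY _] := cY; have [/subsetP sY _ _] := bY.
have [xG yG] := adj_gV xy.
have [xS yS] := (in_both d2 (sY _ xY) xG, in_both d2 (sY _ yY) yG).
have xyG : adj G2 x y by rewrite (adj_S e2).
by apply: (carries_transfer wG2 wH _ e2 _ xS yS xyG xY yY cY) => // B B'; apply: gG_const.
Qed.

(** [colour_glue] is applied to the colour of lying in a carrying block, starting from an edge of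
    [B0]. A coloured edge of [G2] or [H] can be carried on its own side, and the carrying block
    absorbs every biconnected set through that edge. *)
Lemma edge_carried x y : x \in X -> y \in X -> adj K2 x y ->
  exists Y : {set T}, [/\ carries G2 Y \/ carries H Y, x \in Y & y \in Y].
Proof.
pose col x y := `[< exists Y : {set T}, [/\ carries G2 Y \/ carries H Y, x \in Y & y \in Y] >].
have bicX := block_bic wK2 bX.
have [sB0S sB0G bB0 B02] := BlockSE wG2 sB0.
have /card_gt0P[a aB] : 0 < #|B0| by apply: ltnW.
have [_ cB0 _] := bB0; have [b bB ab] := cnx_neighbour (wf_sym wG2) cB0 B02 aB.
have [Y0 bY0 BY0] := bic_in_block wG2 sB0G bB0.
move=> xX yX xy; apply/asboolP.
apply: (@colour_glue _ _ _ _ wG2 wH d2 e2 spl col _ _ _ X bicX a b) => //.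
- by move=> u v; apply: asbool_equiv_eq; split=> -[Y [? ? ?]]; exists Y.
- suff imp (Z : {set T}) v s t : bic (adj G2) Z -> v \in Z -> s \in Z -> t \in Z ->
      adj G2 v s -> col v s -> col v t.
    by move=> Z bZ v s t vZ sZ tZ vs vt; apply/idP/idP; apply: imp bZ _ _ _ _.
  move=> bZ vZ sZ tZ vs /asboolP[Y [cY vY sY]]; apply/asboolP.
  have [W [cW vW sW]] : exists W : {set T}, [/\ carries G2 W, v \in W & s \in W].
    by case: cY => cY; [exists Y | apply: G_carries cY].
  exists W; split=> //; first by left.
  have [bW _] := cW; apply: (subsetP (bic_sub_block wG2 bW _ bZ (ne wG2 vs) _ _ _ _)) => //.
  by apply: bic_gV => //; apply/card_gt1P; exists v, s; rewrite (ne wG2 vs).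
- suff imp (Z : {set T}) v s t : bic (adj H) Z -> v \in Z -> s \in Z -> t \in Z ->
      adj H v s -> col v s -> col v t.
    by move=> Z bZ v s t vZ sZ tZ vs vt; apply/idP/idP; apply: imp bZ _ _ _ _.
  move=> bZ vZ sZ tZ vs /asboolP[Y [cY vY sY]]; apply/asboolP.
  have [W [cW vW sW]] : exists W : {set T}, [/\ carries H W, v \in W & s \in W].
    by case: cY => cY; [apply: H_carries cY | exists Y].
  exists W; split=> //; first by right.
  have [bW _] := cW; apply: (subsetP (bic_sub_block wH bW _ bZ (ne wH vs) _ _ _ _)) => //.
  by apply: bic_gV => //; apply/card_gt1P; exists v, s; rewrite (ne wH vs).
- exact: (subsetP B0X).
- exact: (subsetP B0X).
- by rewrite (adj_gsum wG2 wH) ab.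
- apply/asboolP; exists Y0; rewrite !(subsetP BY0) //; split=> //; left; split=> //.
  by exists B0.
Qed.

Lemma edge_carried_G x y : x \in X -> y \in X -> adj G2 x y ->
  exists Y : {set T}, [/\ carries G2 Y, Y \subset X, x \in Y & y \in Y].
Proof.
move=> xX yX xy; have [|Y [cY xY yY]] := edge_carried xX yX.
  by rewrite (adj_gsum wG2 wH) xy.
have [Z [cZ xZ yZ]] : exists Z : {set T}, [/\ carries G2 Z, x \in Z & y \in Z].
  by case: cY => cY; [exists Y | apply: G_carries cY].
by exists Z; split=> //; have [bZ _] := cZ; apply: subX_G bZ xy _ _ _ _.
Qed.

Lemma edge_carried_H x y : x \in X -> y \in X -> adj H x y ->
  exists Y : {set T}, [/\ carries H Y, Y \subset X, x \in Y & y \in Y].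
Proof.
move=> xX yX xy; have [|Y [cY xY yY]] := edge_carried xX yX.
  by rewrite (adj_gsum wG2 wH) xy orbT.
have [Z [cZ xZ yZ]] : exists Z : {set T}, [/\ carries H Z, x \in Z & y \in Z].
  by case: cY => cY; [apply: H_carries cY | exists Y].
by exists Z; split=> //; have [bZ _] := cZ; apply: subX_H bZ xy _ _ _ _.
Qed.

(** Clause (a) only embeds [Y] into [Q]. The last conclusion is where (d) enters: at a vertex
    outside [S] every neighbour in [Q] is realised in [Y]. *)
Lemma carries_G_liso Y : carries G2 Y ->
  [/\ Y \subset gV G2, {in Y &, injective L2},
      {in Y &, forall x y, adj Q (L2 x) (L2 y) = adj G2 x y} &
      {in Y :\: S, forall u z, adj Q (L2 u) z ->
         exists t, [/\ t \in Y, adj G2 u t & L2 t = z]}].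
Proof.
move=> [bY [B [sB BY gB]]]; have [sY _ _] := bY.
have [_ /(_ Y bY BY)[lab _ _ dd]] := ch2 sB.
have [inj ee] := partial_lisoE wG2 (wg sB) sY lab.
split=> //; first by rewrite -gB.
move=> u uYS; have /setDP[uY _] := uYS; move=> z.
have wI := wf_induced Y wG2.
have sN : cnbhd (induced G2 Y) u \subset gV (induced G2 Y).
  apply/subsetP => x; rewrite !inE => /predU1P[->|/adj_gV[_]].
    by rewrite uY (subsetP sY).
  by rewrite inE.
have /(lisoP _ wI (wf_induced _ (wg sB)) sN)[_ im _] := dd u (or_introl uYS).
rewrite -gB => uz.
have : z \in L2 @: cnbhd (induced G2 Y) u.
  by rewrite im !inE uz orbT; case/adj_gV: uz => _ ->.
case/imsetP=> t; rewrite !inE => /predU1P[-> ez|].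
  by move: uz; rewrite ez (wf_irr (wg sB)).
by rewrite adj_induced => /and3P[ut _ tY] ->; exists t.
Qed.

Lemma carries_H_liso Z : carries H Z ->
  [/\ Z \subset gV H, {in Z &, injective LH} &
      {in Z &, forall x y, adj Q (LH x) (LH y) = adj H x y}] /\
  exists X1, [/\ is_block K1 X1, Z \subset X1, {in X1 &, injective l1},
    l1 @: X1 = gV Q & {in X1 &, forall x y, adj Q (l1 x) (l1 y) = adj K1 x y}].
Proof.
move=> [bZ [B [sB BZ gB]]]; have [sZ _ _] := bZ.
have [X1 [bX1 ZX inj im ee]] := H_block_in_K1 bZ sB BZ; rewrite gB in im ee.
split; last by exists X1.
have lH x : x \in Z -> l1 x = LH x by move=> xZ; apply: (lsum_r c1); apply: (subsetP sZ).
split=> // x y xZ yZ.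
  by rewrite -!lH //; apply: inj; apply: (subsetP ZX).
by rewrite -!lH // ee ?(subsetP ZX) // (adj_KH wG1 wH d1 e1) ?(subsetP sZ).
Qed.

Let l2G x : x \in gV G2 -> l2 x = L2 x.
Proof. exact: lsum_l. Qed.

Let l2H x : x \in gV H -> l2 x = LH x.
Proof. exact: (lsum_r c2). Qed.

(** * Common neighbours of the ends of an edge *)

Lemma edge_hom : {in X &, forall x y, adj K2 x y -> adj Q (l2 x) (l2 y)}.
Proof.
move=> x y xX yX; rewrite (adj_gsum wG2 wH) => /orP[] xy; have [xF yF] := adj_gV xy.
  have [Y [/carries_G_liso[_ _ ee _] _ xY yY]] := edge_carried_G xX yX xy.
  by rewrite !l2G // ee.
have [Z [/carries_H_liso[[_ _ ee] _] _ xZ yZ]] := edge_carried_H xX yX xy.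
by rewrite !l2H // ee.
Qed.

(** The local condition that [link_covering_iso] requires of the edge [wu]. *)
Definition link_iso (w u : T) : Prop :=
  let N := [set x in X | adj K2 w x && adj K2 u x] in
  [/\ {in N &, injective l2}, {in N &, forall x y, adj Q (l2 x) (l2 y) -> adj K2 x y} &
      forall z, adj Q (l2 w) z -> adj Q (l2 u) z -> exists2 x, x \in N & l2 x = z].

Lemma link_isoC w u : link_iso w u -> link_iso u w.
Proof.
rewrite /link_iso (_ : [set x in X | adj K2 u x && adj K2 w x] =
  [set x in X | adj K2 w x && adj K2 u x]); last first.
  by apply/setP => x; rewrite !inE [adj K2 u x && _]andbC.
by move=> /= [inj rf sur]; split=> // z zu zw; apply: sur.
Qed.

Lemma triangle_block (F : graph T) Y w u t : wf F -> is_block F Y -> w \in Y -> u \in Y ->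
  adj F w u -> adj F w t -> adj F u t -> t \in Y.
Proof.
move=> wF bY wY uY wu wt ut; have [sF iF] := (wf_sym wF, wf_irr wF).
have bt := bic_triangle sF iF wu ut wt.
have sub : [set x in [:: w; u; t]] \subset gV F.
  have [[wF' uF] [_ tF]] := (adj_gV wu, adj_gV wt).
  by apply/subsetP => x; rewrite !inE => /or3P[] /eqP->.
apply: (subsetP (bic_sub_block wF bY sub bt (ne wF wu) _ _ wY uY)); by rewrite !inE eqxx ?orbT.
Qed.

(** The end [u] has no neighbour outside [G2], so all common neighbours fall in one block [Y], and
    those required by [Q] are supplied by clause (d) at [u]. *)
Lemma link_iso_G w u : w \in X -> u \in X -> adj G2 w u -> u \notin S -> link_iso w u.
Proof.
move=> wX uX wu uS; have [wG uG] := adj_gV wu.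
have [Y [cY YX wY uY]] := edge_carried_G wX uX wu; have [bY _] := cY.
have [sY inj ee sur] := carries_G_liso cY.
have uH : u \notin gV H by apply: contra uS => uH; apply: (in_both d2 uG uH).
have Nin x : adj K2 w x -> adj K2 u x -> x \in Y.
  move=> wx; rewrite (adj_gsum wG2 wH) => /orP[ux|/adj_gV[]]; last by rewrite (negPf uH).
  have [_ xG] := adj_gV ux; rewrite (adj_KG wG2 wH d2 e2 wG xG) in wx.
  exact: (triangle_block wG2 bY wY uY wu wx ux).
have l2Y x : x \in Y -> l2 x = L2 x by move=> /(subsetP sY)/l2G.
split=> [x y|x y|z].
- rewrite !inE => /and3P[_ wx ux] /and3P[_ wy uy].
  have [xY yY] := (Nin x wx ux, Nin y wy uy).
  by rewrite !l2Y //; apply: inj.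
- rewrite !inE => /and3P[_ wx ux] /and3P[_ wy uy].
  have [xY yY] := (Nin x wx ux, Nin y wy uy).
  by rewrite !l2Y // ee // (adj_gsum wG2 wH) => ->.
- rewrite !l2Y // => wz uz; have [|t [tY ut tz]] := sur u _ z uz; first by rewrite inE uS.
  exists t; last by rewrite l2Y.
  by rewrite !inE (subsetP YX) // !(adj_gsum wG2 wH) ut -ee // tz wz.
Qed.

(** A common neighbour in [Q] is realised in the block [X1] of the first sum. Since [u] lies in [H]
    alone, that vertex is in [H], hence in [Z] and in [X]. *)
Lemma link_iso_H w u : w \in X -> u \in X -> adj H w u -> u \notin S -> link_iso w u.
Proof.
move=> wX uX wu uS; have [wF uF] := adj_gV wu.
have [Z [cZ ZX wZ uZ]] := edge_carried_H wX uX wu; have [bZ _] := cZ.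
have [[sZ inj ee] [X1 [bX1 ZX1 inj1 im1 ee1]]] := carries_H_liso cZ.
have uG : u \notin gV G2 by apply: contra uS => uG; apply: (in_both d2 uG uF).
have uG1 : u \notin gV G1 by apply: contra uS => uG1; apply: (in_both d1 uG1 uF).
have Nin x : adj K2 w x -> adj K2 u x -> x \in Z.
  move=> wx; rewrite (adj_gsum wG2 wH) => /orP[/adj_gV[]|ux]; first by rewrite (negPf uG).
  have [_ xF] := adj_gV ux; rewrite (adj_KH wG2 wH d2 e2 wF xF) in wx.
  exact: (triangle_block wH bZ wZ uZ wu wx ux).
have l2Z x : x \in Z -> l2 x = LH x by move=> /(subsetP sZ)/l2H.
have l1Z x : x \in gV H -> l1 x = LH x by apply: (lsum_r c1).
split=> [x y|x y|z].
- rewrite !inE => /and3P[_ wx ux] /and3P[_ wy uy].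
  have [xY yY] := (Nin x wx ux, Nin y wy uy).
  by rewrite !l2Z //; apply: inj.
- rewrite !inE => /and3P[_ wx ux] /and3P[_ wy uy].
  have [xY yY] := (Nin x wx ux, Nin y wy uy).
  by rewrite !l2Z // ee // (adj_gsum wG2 wH) orbC => ->.
- rewrite !l2Z // => wz uz; have : z \in l1 @: X1 by rewrite im1; case/adj_gV: wz.
  case/imsetP=> t tX1 tz; have [wX1 uX1] := (subsetP ZX1 _ wZ, subsetP ZX1 _ uZ).
  rewrite tz -!l1Z // !ee1 // in wz uz.
  move: uz; rewrite (adj_gsum wG1 wH) => /orP[/adj_gV[]|ut]; first by rewrite (negPf uG1).
  have [_ tH] := adj_gV ut; rewrite (adj_KH wG1 wH d1 e1 wF tH) in wz.
  have tZ := triangle_block wH bZ wZ uZ wu wz ut.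
  exists t; last by rewrite l2H // tz l1Z.
  by rewrite !inE (subsetP ZX) // !(adj_gsum wG2 wH) ut wz !orbT.
Qed.

(** Equality of the two values of [h] provides [t'] with the label of [t]; its adjacency to [w] and
    [u] is then read off in [Q]. *)
Lemma nbhd_transfer (F F' : graph T) (L L' : T -> 'I_d) (Y Y' B : {set T}) w u t :
  Y \subset gV F ->
  {in Y &, forall x y, adj Q (L x) (L y) = adj F x y} ->
  {in Y' &, forall x y, adj Q (L' x) (L' y) = adj F' x y} ->
  L @: (nbhd (induced F Y) B :\: S) = L' @: (nbhd (induced F' Y') B :\: S) ->
  B \subset S -> B \subset Y -> B \subset Y' -> w \in B -> u \in B ->
  L w = L' w -> L u = L' u ->
  t \in Y -> t \notin S -> adj F w t -> adj F u t ->
  exists t', [/\ t' \in Y', t' \notin S, L' t' = L t, adj F' w t' & adj F' u t'].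
Proof.
move=> sY ee ee' hE sBS BY BY' wB uB Lw Lu tY tS wt ut.
have [wY uY] := (subsetP BY _ wB, subsetP BY _ uB).
have [wY' uY'] := (subsetP BY' _ wB, subsetP BY' _ uB).
have : L t \in L @: (nbhd (induced F Y) B :\: S).
  apply: imset_f; rewrite !inE tS tY (subsetP sY) //=.
  rewrite (contra (subsetP sBS t) tS) /=; apply/existsP; exists w.
  by rewrite wB adj_induced /rel_in wt wY tY.
rewrite hE => /imsetP[t']; rewrite !inE => /andP[t'S /and3P[_ /andP[t'Y' _] _]] Lt.
exists t'; split=> //; first by rewrite -ee' // -Lw -Lt ee.
by rewrite -ee' // -Lu -Lt ee.
Qed.

(** Common neighbours lie in the block [Y] of [G2] or the block [Z] of [H]. In the first sum [Y1]
    and [Z] both lie in [X1], a copy of [Q], and [h] matches the labels of the neighbours of [B] off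
    [S] in [Y] and in [Y1]. *)
Lemma link_iso_S w u : w \in X -> u \in X -> adj G2 w u -> w \in S -> u \in S ->
  link_iso w u.
Proof.
move=> wX uX wu wS uS; have [B [sB wB uB]] := edge_BlockS wG2 wS uS wu.
have [Y [cY YX wY uY]] := edge_carried_G wX uX wu; have [bY [B' [sB' B'Y gB']]] := cY.
have BY := S_edge wG2 (erefl _) bY wS uS wu wY uY sB wB uB.
have gB : g B = Q by rewrite (gG_const bY sB' sB).
have [sYG inj ee _] := carries_G_liso cY.
have wuH : adj H w u by rewrite -(adj_S e2).
have [[wG uG] [wH' uH']] := (adj_gV wu, adj_gV wuH).
have [sBS sBH bBH B2] := BlockSE wH (BlockSH sB).
have [Z bZ BZ] := bic_in_block wH sBH bBH.
have cZ : carries H Z by split=> //; exists B.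
have [wZ uZ] := (subsetP BZ _ wB, subsetP BZ _ uB).
have ZX := subX_H bZ wuH wX uX wZ uZ.
have [[sZH injH eeH] [X1 [bX1 ZX1 inj1 im1 ee1]]] := carries_H_liso cZ.
have [wX1 uX1] := (subsetP ZX1 _ wZ, subsetP ZX1 _ uZ).
have [_ sB1 bB1 _] := BlockSE wG1 (BlockS1 sB).
have [Y1 bY1 BY1] := bic_in_block wG1 sB1 bB1.
have [wY1 uY1] := (subsetP BY1 _ wB, subsetP BY1 _ uB).
have [sY1 _ _] := bY1.
have Y1X1 : Y1 \subset X1.
  apply: (bic_sub_block wK1 bX1 _ _ (ne wH wuH)) => //.
    exact: subset_trans sY1 (subsetUl _ _).
  by apply/(bic_KG wG1 wH d1 e1 sY1); apply: block_bic.
have [_ /(_ Y bY BY)[_ _ hE2 _]] := ch2 sB.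
have [_ /(_ Y1 bY1 BY1)[lab1 _ hE1 _]] := ch1 (BlockS1 sB).
have [_ eeY1] := partial_lisoE wG1 (wg sB) sY1 lab1; rewrite gB in eeY1.
have L12 x : x \in S -> L1 x = L2 x.
  by have [[_ _ L1S] [_ _ L2S]] := (c1, c2) => xS; rewrite L1S // L2S.
have wu1 : adj G1 w u by rewrite (adj_S e1).
have inS (F : graph T) x : induced F S = induced H S -> x \in S ->
    (x \in gV F) = (x \in gV H).
  by move=> /(congr1 (fun F' => x \in gV F')) /=; rewrite !inE => + xS; rewrite xS.
have NG x : adj K2 w x -> adj K2 u x -> x \in gV G2 ->
    [/\ x \in Y, adj G2 w x & adj G2 u x].
  move=> wx ux xG; rewrite !(adj_KG wG2 wH d2 e2) // in wx ux.
  by split=> //; apply: (triangle_block wG2 bY wY uY wu).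
have NH x : adj K2 w x -> adj K2 u x -> x \in gV H ->
    [/\ x \in Z, adj H w x & adj H u x].
  move=> wx ux xH; rewrite !(adj_KH wG2 wH d2 e2) // in wx ux.
  by split=> //; apply: (triangle_block wH bZ wZ uZ wuH).
have Nor x : adj K2 w x -> (x \in gV G2) || (x \in gV H).
  by case/adj_gV=> _; rewrite inE.
have l1H x : x \in gV H -> l1 x = LH x by apply: (lsum_r c1).
(* A private common neighbour in [G2] and one in [H] are told apart in the first sum. *)
have mixed x y : adj K2 w x -> adj K2 u x -> adj K2 w y -> adj K2 u y ->
    x \notin gV H -> y \notin gV G2 ->
    l2 x <> l2 y /\ ~~ adj Q (l2 x) (l2 y).
  move=> wx ux wy uy xH yG.
  have xG : x \in gV G2 by have := Nor x wx; rewrite (negPf xH) orbF.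
  have yH : y \in gV H by have := Nor y wy; rewrite (negPf yG).
  have xS : x \notin S by apply: contra xH => xS; rewrite -(inS G2).
  have yG1 : y \notin gV G1.
    by apply: contra yG => yG1; rewrite (inS G2) // (in_both d1).
  have [xY wxG uxG] := NG x wx ux xG; have [yZ _ _] := NH y wy uy yH.
  have [x1 [x1Y x1S Lx1 wx1 ux1]] := nbhd_transfer sYG ee eeY1
    (etrans (esym hE2) hE1) sBS BY BY1 wB uB (esym (L12 _ wS)) (esym (L12 _ uS)) xY xS wxG uxG.
  have x1G := subsetP sY1 _ x1Y.
  have x1H : x1 \notin gV H by apply: contra x1S; apply: (in_both d1).
  have [x1X yX1] := (subsetP Y1X1 _ x1Y, subsetP ZX1 _ yZ).
  have lx : l2 x = l1 x1 by rewrite l2G // /l1 lsum_l.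
  have ly : l2 y = l1 y by rewrite l2H // l1H.
  rewrite lx ly; split=> [/(inj1 _ _ x1X yX1) xy|]; first by rewrite xy yH in x1H.
  rewrite ee1 // (adj_gsum wG1 wH); apply/norP.
  by split; apply/negP => /adj_gV[]; rewrite ?(negPf yG1) ?(negPf x1H).
(* Common neighbours whose labels are equal or adjacent thus lie on a common side, where the labels
   of a single block decide. *)
have same x y : adj K2 w x -> adj K2 u x -> adj K2 w y -> adj K2 u y ->
    l2 x = l2 y \/ adj Q (l2 x) (l2 y) ->
    (x \in gV G2) && (y \in gV G2) || (x \in gV H) && (y \in gV H).
  move=> wx ux wy uy lxy; have [xG|xG] := boolP (x \in gV G2).
    have [yG|yG] := boolP (y \in gV G2); first by [].
    have yH : y \in gV H by have := Nor y wy; rewrite (negPf yG).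
    have [xH|xH] := boolP (x \in gV H); first by rewrite yH.
    have [ne_l /negPf nadj] := mixed x y wx ux wy uy xH yG.
    by case: lxy => [/ne_l|]; rewrite ?nadj.
  have xH : x \in gV H by have := Nor x wx; rewrite (negPf xG).
  have [yH|yH] := boolP (y \in gV H); first by rewrite xH.
  have [ne_l /negPf nadj] := mixed y x wy uy wx ux yH xG.
  by case: lxy => [/esym/ne_l|]; rewrite // (wf_sym wQ) nadj.
split=> [x y|x y|z].
- rewrite !inE => /and3P[_ wx ux] /and3P[_ wy uy] lxy.
  case/orP: (same x y wx ux wy uy (or_introl lxy)) => /andP[xF yF].
    have [[xY _ _] [yY _ _]] := (NG x wx ux xF, NG y wy uy yF).
    by apply: inj; rewrite -?l2G.
  have [[xZ _ _] [yZ _ _]] := (NH x wx ux xF, NH y wy uy yF).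
  by apply: injH; rewrite -?l2H.
- rewrite !inE => /and3P[_ wx ux] /and3P[_ wy uy] lxy.
  case/orP: (same x y wx ux wy uy (or_intror lxy)) => /andP[xF yF].
    have [[xY _ _] [yY _ _]] := (NG x wx ux xF, NG y wy uy yF).
    by rewrite (adj_gsum wG2 wH) -ee // -!l2G // lxy.
  have [[xZ _ _] [yZ _ _]] := (NH x wx ux xF, NH y wy uy yF).
  by rewrite (adj_gsum wG2 wH) -eeH // -!l2H // lxy orbT.
(* For surjectivity, [z] is first realised by [t] in [X1]. If [t] is in [H] it lies in [Z];
   otherwise it is in [G1] off [S], and [h] moves it to [G2]. *)
move=> wz uz; have : z \in l1 @: X1 by rewrite im1; case/adj_gV: wz.
case/imsetP=> t tX1 tz.
rewrite tz !l2H // -!l1H // !ee1 // in wz uz.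
have [tH|tH] := boolP (t \in gV H).
  rewrite !(adj_KH wG1 wH d1 e1) // in wz uz.
  have tZ := triangle_block wH bZ wZ uZ wuH wz uz.
  exists t; last by rewrite l2H // tz l1H.
  by rewrite !inE (subsetP ZX) // !(adj_gsum wG2 wH) wz uz !orbT.
have tG : t \in gV G1 by case/adj_gV: wz => _; rewrite inE (negPf tH) orbF.
have [wG1' uG1'] := adj_gV wu1.
rewrite !(adj_KG wG1 wH d1 e1) // in wz uz.
have tY1 := triangle_block wG1 bY1 wY1 uY1 wu1 wz uz.
have tS : t \notin S by apply: contra tH => tS; rewrite -(inS G1).
have [t2 [t2Y t2S Lt2 wt2 ut2]] := nbhd_transfer sY1 eeY1 ee
  (etrans (esym hE1) hE2) sBS BY1 BY wB uB (L12 _ wS) (L12 _ uS) tY1 tS wz uz.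
exists t2; last by rewrite l2G ?(subsetP sYG) // Lt2 tz /l1 lsum_l.
by rewrite !inE (subsetP YX) // !(adj_gsum wG2 wH) wt2 ut2.
Qed.

Lemma S_block_liso : liso (induced K2 X) l2 Q id.
Proof.
have [sX _ _] := bX; have [_ cX _] := block_bic wK2 bX.
apply/(lisoP _ wK2 wQ sX).
have [_ [bQ _]] := UQ.
apply: (link_covering_iso wQ bQ (Pch (Ud_class UQ)) (wf_sym wK2) cX).
- have [_ _ _ B02] := BlockSE wG2 sB0.
  exact: leq_trans B02 (subset_leq_card B0X).
- by move=> w; apply: (link_glue wG2 wH d2 e2 spl) bX => Y bY;
    apply: Pch; [apply: PG2 | apply: PH].
- exact: edge_hom.
(* An edge leaving [S] is treated on its own side, oriented so that an end outside [S] comes second.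
   An edge inside [S] belongs to both graphs. *)
have GH (F : graph T) w u : (forall a b, a \in X -> b \in X -> adj F a b -> b \notin S ->
    link_iso a b) -> wf F -> induced G2 S = induced F S ->
    w \in X -> u \in X -> adj F w u -> link_iso w u.
  move=> side wF eF wX uX wu.
  have [uS|uS] := boolP (u \in S); last exact: side.
  have [wS|wS] := boolP (w \in S); last by apply/link_isoC/side; rewrite // (wf_sym wF).
  by apply: link_iso_S; rewrite ?(adj_S eF).
move=> w u wX uX; rewrite (adj_gsum wG2 wH) => /orP[] wu.
  exact: (GH G2 w u link_iso_G).
exact: (GH H w u link_iso_H).
Qed.

End Exchange.

(** * All blocks of the second sum *)

Lemma class_biconnected_sub (P : gclass) (d : nat) (T : finType) (F : graph T)
    (L : T -> 'I_d) (X : {set T}) : block_hereditary P -> labeled_Pblock P F L ->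
  X \subset gV F -> bic (adj F) X -> P T (induced F X) /\ {in X &, injective L}.
Proof.
move=> Phered [wF [PF bl]] sX bX.
have [Y bY XY] := bic_in_block wF sX bX; split; last first.
  by move=> x y /(subsetP XY) xY /(subsetP XY) yY; apply: (bl Y bY).
rewrite -(induced_induced F XY); apply: Phered (PF Y bY) _.
by rewrite induced_induced //; apply/biconnected_inducedE.
Qed.

Lemma induced_gsum (T : finType) (G H : graph T) (S X : {set T}) : wf G -> wf H ->
  [disjoint gV G :\: S & gV H :\: S] -> induced G S = induced H S ->
  X \subset gV G -> induced (gsum G H) X = induced G X.
Proof.
move=> wG wH dGH eGH sX; rewrite /induced; congr Graph.
  by rewrite (setIidPl sX) (setIidPl (subset_trans sX (subsetUl _ _))).
apply/setP => -[x y]; rewrite !inE /=; apply: andb_id2r => /andP[xX yX].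
have [xG yG] := (subsetP sX _ xX, subsetP sX _ yX).
have := adj_KG wG wH dGH eGH xG yG.
by rewrite -(wf_gE x y (wf_gsum wG wH)) -(wf_gE x y wG) inE.
Qed.

(** If no edge of [X] lies inside [S], then any edge of [X] belongs to [G] or to [H], and
    [block_on_side] confines [X] to that side. *)
Lemma block_gsum_cases (T : finType) (G H : graph T) (S X : {set T}) : wf G -> wf H ->
  S \subset gV G -> S \subset gV H ->
  [disjoint gV G :\: S & gV H :\: S] -> induced G S = induced H S -> splits G H S ->
  is_block (gsum G H) X ->
  [\/ exists2 B, BlockS G S B & B \subset X, X \subset gV G | X \subset gV H].
Proof.
move=> wG wH sG sH dGH eGH spl bX.
have dHG : [disjoint gV H :\: S & gV G :\: S] by rewrite disjoint_sym.
have wK := wf_gsum wG wH; have [sX _ _] := bX; have [X0 cX _] := block_bic wK bX.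
(* A one-vertex block has no edge to start from and is placed directly. *)
have [X2|X1] := ltnP 1 #|X|; last first.
  have /cards1P[x eX] : #|X| == 1 by rewrite eqn_leq X1 card_gt0.
  have : x \in gV G :|: gV H by rewrite (subsetP sX) // eX inE.
  by rewrite inE eX !sub1set => /orP[]; [constructor 2 | constructor 3].
have [/existsP[x /existsP[y /and5P[xX yX xS yS xy]]]|nS] :=
    boolP [exists x, exists y, [&& x \in X, y \in X, x \in S, y \in S & adj G x y]].
  constructor 1; have [B [sB xB yB]] := edge_BlockS wG xS yS xy; exists B => //.
  have [_ sBG bB _] := BlockSE wG sB.
  have ne : x != y by apply: contraTneq xy => ->; rewrite (wf_irr wG).
  apply: (bic_sub_block wK bX _ _ ne) => //; first exact: subset_trans sBG (subsetUl _ _).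
  by apply/(bic_KG wG wH dGH eGH sBG).
have nSG : {in X :&: S &, forall x y, ~~ adj G x y}.
  move=> x y /setIP[xX xS] /setIP[yX yS]; apply: contra nS => xy.
  by apply/existsP; exists x; apply/existsP; exists y; rewrite xX yX xS yS.
have /card_gt0P[a aX] : 0 < #|X| by apply: ltnW.
have [b bX' ab] := cnx_neighbour (wf_sym wK) cX X2 aX.
move: ab; rewrite (adj_gsum wG wH) => /orP[] ab.
  by constructor 2; apply: (block_on_side wG wH dGH eGH spl bX nSG aX bX' ab).
constructor 3; rewrite gsumC in bX.
apply: (block_on_side wH wG dHG (esym eGH) (splitsC eGH spl) bX _ aX bX' ab).
move=> x y xXS yXS; have [/setIP[_ xS] /setIP[_ yS]] := (xXS, yXS).
by rewrite -(adj_S eGH) // nSG.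
Qed.

Theorem theorem5p1 (d : nat) (P : gclass) (T : finType)
    (G1 G2 H : graph T) (S : {set T})
    (L1 L2 LH : T -> 'I_d)
    (g : {set T} -> graph 'I_d) (h : {set T} -> {set 'I_d}) :
  2 <= d ->
  iso_closed P -> block_hereditary P -> chordal_class P ->
  labeled_bgraph P G1 S L1 -> labeled_bgraph P G2 S L2 -> labeled_bgraph P H S LH ->
  compatible G1 L1 H LH S -> compatible G2 L2 H LH S ->
  characteristic P G1 S L1 g h -> characteristic P G2 S L2 g h ->
  acyclic (aux_sum G2 H S) ->
  labeled_Pblock P (gsum G1 H) (lsum G1 L1 LH) ->
  respects G1 S L1 H LH g ->
  labeled_Pblock P (gsum G2 H) (lsum G2 L2 LH) /\ respects G2 S L2 H LH g.
Proof.
move=> _ Piso Phered Pch [sS1 lP1] [sS2 lP2] [sSH lPH] c1 c2 ch1 ch2 ac _ resp.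
have [[w1 _] [[w2 [P2 _]] [wH [PH _]]]] := (lP1, (lP2, lPH)).
have [d2 e2 _] := c2; have spl := aux_splits w2 wH sS2 sSH e2 ac.
(* This comes first because it also settles the class and the labels of every block containing an
   element of [Block(G2, S)]. *)
have resp2 : respects G2 S L2 H LH g.
  move=> B sB X bX BX.
  exact: (S_block_liso Pch w1 w2 wH P2 PH c1 c2 ch1 ch2 spl resp bX sB BX).
have wK := wf_gsum w2 wH.
have blockP X : is_block (gsum G2 H) X ->
    P T (induced (gsum G2 H) X) /\ {in X &, injective (lsum G2 L2 LH)}.
  move=> bX; have [sX _ _] := bX; have bicX := block_bic wK bX.
  case: (block_gsum_cases w2 wH sS2 sSH d2 e2 spl bX) => [[B sB BX]|sXG|sXH].
  - have lX := resp2 B sB X bX BX; have [UB _] := ch2 B sB; have [wB _] := UB.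
    split; last by have /(lisoP _ wK wB sX)[] := lX.
    apply: Piso (Ud_class UB); apply: iso_sym; last by case: lX => f []; exists f.
    by rewrite /= (setIidPl sX); case: bicX.
  - rewrite (induced_gsum w2 wH d2 e2 sXG).
    have [PX inj] := class_biconnected_sub Phered lP2 sXG
      (proj1 (bic_KG w2 wH d2 e2 sXG) bicX).
    by split=> // x y xX yX; rewrite !lsum_l ?(subsetP sXG) //; apply: inj.
  - have dH : [disjoint gV H :\: S & gV G2 :\: S] by rewrite disjoint_sym.
    rewrite gsumC (induced_gsum wH w2 dH (esym e2) sXH).
    have [PX inj] := class_biconnected_sub Phered lPH sXH
      (proj1 (bic_KH w2 wH d2 e2 sXH) bicX).
    by split=> // x y xX yX; rewrite !(lsum_r c2) ?(subsetP sXH) //; apply: inj.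
by split=> //; split=> //; split=> X /blockP[].
Qed.
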